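(* Let $N\ge3$ and let $\Delta\colon Y(\hat{\mathfrak{sl}}_N)\to Y(\hat{\mathfrak{sl}}_N)\,\widehat{\otimes}\,Y(\hat{\mathfrak{sl}}_N)$ be the coproduct of the affine Yangian and $T_i$ ($i\in\mathbb{Z}/N\mathbb{Z}$) the braid group operators (see context). Then for every $i\in\mathbb{Z}/N\mathbb{Z}$, $$\Delta\circ T_i=(T_i\otimes T_i)\circ\Delta.$$
   Context: Affine Yangian. $Y=Y(\hat{\mathfrak{sl}}_N)$ is the $\mathbb{C}$-algebra generated by $x_{i,r}^{+},x_{i,r}^-,h_{i,r}$ ($i\in\mathbb{Z}/N\mathbb{Z}$, $r\in\mathbb{Z}_{\ge0}$) with parameters $\varepsilon_1,\varepsilon_2\in\mathbb{C}$ and relations $[h_{i,r},h_{j,s}]=0$, $[x_{i,r}^+,x_{j,s}^-]=\delta_{ij}h_{i,r+s}$, $[h_{i,0},x_{j,r}^\pm]=\pm a_{ij}x_{j,r}^\pm$, $[h_{i,r+1},x_{j,s}^\pm]-[h_{i,r},x_{j,s+1}^\pm]=\pm a_{ij}\frac{\varepsilon_1+\varepsilon_2}{2}\{h_{i,r},x_{j,s}^\pm\}-m_{ij}\frac{\varepsilon_1-\varepsilon_2}{2}[h_{i,r},x_{j,s}^\pm]$, $[x_{i,r+1}^\pm,x_{j,s}^\pm]-[x_{i,r}^\pm,x_{j,s+1}^\pm]=\pm a_{ij}\frac{\varepsilon_1+\varepsilon_2}{2}\{x_{i,r}^\pm,x_{j,s}^\pm\}-m_{ij}\frac{\varepsilon_1-\varepsilon_2}{2}[x_{i,r}^\pm,x_{j,s}^\pm]$,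 $\sum_{w\in\mathfrak{S}_{1-a_{ij}}}[x_{i,r_{w(1)}}^\pm,[x_{i,r_{w(2)}}^\pm,\dots,[x_{i,r_{w(1-a_{ij})}}^\pm,x_{j,s}^\pm]\dots]]=0$ for $i\ne j$. Here $\{x,y\}=xy+yx$; $a_{ij}=2$ if $i=j$, $-1$ if $i=j\pm1$, $0$ otherwise; $m_{ij}=1$ if $j=i-1$, $-1$ if $j=i+1$, $0$ otherwise. Put $\hbar=\varepsilon_1+\varepsilon_2$, $x_i^\pm=x_{i,0}^\pm$, $h_i=h_{i,0}$, $\tilde h_{i,1}=h_{i,1}-\frac{\hbar}{2}h_i^2$. The subalgebra generated by the $x_i^\pm,h_i$ is $U(\hat{\mathfrak{sl}}_N)$, with $x_i^\pm,h_i$ the Chevalley generators. Braid operators: $T_i=\exp\mathrm{ad}\,x_i^+\,\exp\mathrm{ad}(-x_i^-)\,\exp\mathrm{ad}\,x_i^+$, an algebra automorphism of $Y$ (the $\mathrm{ad}\,x_i^\pm$ are locally nilpotent). Coproduct. Let $\hat{\mathfrak{sl}}_N\oplus\mathbb{C}d$ be the affine Lie algebra with degree operator, with a nondegenerate invariant symmetric bilinear form $(\,,\,)$ such that $(x_i^+,x_i^-)=1$; $\hat\Delta_+$ is its set of positive roots and $\mathrm{mult}\,\alpha$ the dimension of the root space of $\alpha$. Let $\{u_k\},\{u^k\}$ be dual bases of the Cartan subalgebra, and let $x_\alpha^{(k)}$ ($\alpha$ a root, $1\le k\le\mathrm{mult}\,\alpha$) be a basis of root vectors with $(x_\alpha^{(k)},x_{-\alpha}^{(l)})=\delta_{k,l}$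 and $x_{\pm\alpha_i}^{(1)}=x_i^\pm$. Put $\Omega_+=\sum_k u^k\otimes u_k+\sum_{\alpha\in\hat\Delta_+,\,1\le k\le\mathrm{mult}\,\alpha}x_{-\alpha}^{(k)}\otimes x_\alpha^{(k)}$ and $\square(X)=X\otimes1+1\otimes X$. The completed tensor product $Y\widehat\otimes Y$ consists of the formal infinite sums of elements of $Y\otimes Y$ which are homogeneous of degrees bounded below, one for each degree, where $Y\otimes Y$ is graded by $\deg(x_{i,r}^\pm\otimes1)=\mp1$, $\deg(1\otimes x_{i,r}^\pm)=\pm1$, $\deg(h_{i,r}\otimes 1)=\deg(1\otimes h_{i,r})=0$. It is known that there is a unique algebra homomorphism $\Delta\colon Y\to Y\widehat\otimes Y$ with $\Delta(X)=\square(X)$ for $X=x_i^\pm,h_i$ and $\Delta(x_{i,1}^+)=\square(x_{i,1}^+)-\hbar[1\otimes x_i^+,\Omega_+]$, $\Delta(x_{i,1}^-)=\square(x_{i,1}^-)+\hbar[x_i^-\otimes1,\Omega_+]$, $\Delta(\tilde h_{i,1})=\square(\tilde h_{i,1})+\hbar[h_i\otimes1,\Omega_+]$; these commutators do not involve $d$, e.g. $[1\otimes x_i^+,\Omega_+]=-h_i\otimes x_i^++\sum_{\alpha\in\hat\Delta_+,k}x_{-\alpha}^{(k)}\otimes[x_i^+,x_\alpha^{(k)}]$. The operator $T_i\otimes T_i$ is applied termwise to the infinite sums occurring in the image of $\Delta$. *)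

(* Defs.v *)
From HB Require Import structures.
From mathcomp Require Import all_boot all_order all_fingroup all_algebra.
From mathcomp Require Import all_classical reals complex.

Set Implicit Arguments.
Unset Strict Implicit.
Unset Printing Implicit Defensive.

Import Order.TTheory GRing.Theory Num.Theory.

Local Open Scope classical_set_scope.
Local Open Scope quotient_scope.
Local Open Scope ring_scope.

(** * Algebras given by generators and relations *)

Section Presentation.
Variables (K : fieldType) (G : Type).

Inductive term : Type :=
| TGen of G
| TZero | TOne
| TOpp of term
| TAdd of term & term
| TMul of term & term
| TScale of K & term.

HB.instance Definition _ := Choice.copy term {classic term}.

Fixpoint teval (A : algType K) (rho : G -> A) (t : term) : A :=
  match t with
  | TGen g => rho g
  | TZero => 0
  | TOne => 1
  | TOpp u => - teval rho u
  | TAdd u v => teval rho u + teval rho v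
  | TMul u v => teval rho u * teval rho v
  | TScale a u => a *: teval rho u
  end.

(* [rel A rho] says that the family [rho] satisfies the defining relations.
   The hypothesis [model] only serves to have 1 != 0, which [algType] needs. *)
Variable rel : forall A : algType K, (G -> A) -> Prop.
Hypothesis model : exists A : algType K, exists rho : G -> A, rel rho.

(* Two terms define the same element of the presented algebra iff they agree
   under every family, in any algebra, that satisfies the relations. *)
Definition teq (t u : term) : bool :=
  `[< forall (A : algType K) (rho : G -> A), rel rho ->
        teval rho t = teval rho u >].

Lemma teq_refl : reflexive teq.
Proof. by move=> t; apply/asboolP. Qed.

Lemma teq_sym : symmetric teq.
Proof.
by move=> t u; apply/asboolP/asboolP => tu A rho /tu ->.
Qed.

Lemma teq_trans : transitive teq.
Proof.
move=> u t v /asboolP tu /asboolP uv; apply/asboolP => A rho r.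
by rewrite tu // uv.
Qed.

Canonical teq_equiv := EquivRel teq teq_refl teq_sym teq_trans.

(* [model] is a dummy argument so that the instances below can depend on it. *)
Definition presented of (exists A : algType K, exists rho : G -> A, rel rho) :
  Type := {eq_quot teq}.
Local Notation P := (presented model).
HB.instance Definition _ := Choice.copy P {eq_quot teq}.

Definition pclass (t : term) : P := \pi_{eq_quot teq} t.
Definition prepr (x : P) : term := generic_quotient.repr (x : {eq_quot teq}).

Lemma preprK x : pclass (prepr x) = x.
Proof. exact: reprK. Qed.

Lemma pclassP t u :
  (forall (A : algType K) (rho : G -> A), rel rho ->
     teval rho t = teval rho u) <-> pclass t = pclass u.
Proof.
split=> [tu|/eqmodP /asboolP //].
by apply/eqmodP/asboolP.
Qed.

Lemma prepr_pclass t (A : algType K) (rho : G -> A) : rel rho ->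
  teval rho (prepr (pclass t)) = teval rho t.
Proof. by have /pclassP := preprK (pclass t); apply. Qed.

Lemma peqP (x y : P) :
  (forall (A : algType K) (rho : G -> A), rel rho ->
     teval rho (prepr x) = teval rho (prepr y)) -> x = y.
Proof. by move=> /pclassP; rewrite !preprK. Qed.

Definition pgen (g : G) : P := pclass (TGen g).
Definition pzero : P := pclass TZero.
Definition pone : P := pclass TOne.
Definition popp (x : P) : P := pclass (TOpp (prepr x)).
Definition padd (x y : P) : P := pclass (TAdd (prepr x) (prepr y)).
Definition pmul (x y : P) : P := pclass (TMul (prepr x) (prepr y)).
Definition pscale (a : K) (x : P) : P := pclass (TScale a (prepr x)).

Local Ltac pauto := apply: peqP => A rho r; do ?rewrite prepr_pclass //=.

Lemma paddA : associative padd.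
Proof. by move=> x y z; pauto; rewrite addrA. Qed.
Lemma paddC : commutative padd.
Proof. by move=> x y; pauto; rewrite addrC. Qed.
Lemma padd0 : left_id pzero padd.
Proof. by move=> x; pauto; rewrite add0r. Qed.
Lemma paddN : left_inverse pzero popp padd.
Proof. by move=> x; pauto; rewrite addNr. Qed.

HB.instance Definition _ := GRing.isZmodule.Build P paddA paddC padd0 paddN.

Lemma pmulA : associative pmul.
Proof. by move=> x y z; pauto; rewrite mulrA. Qed.
Lemma pmul1l : left_id pone pmul.
Proof. by move=> x; pauto; rewrite mul1r. Qed.
Lemma pmul1r : right_id pone pmul.
Proof. by move=> x; pauto; rewrite mulr1. Qed.
Lemma pmulDl : left_distributive pmul padd.
Proof. by move=> x y z; pauto; rewrite mulrDl. Qed.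
Lemma pmulDr : right_distributive pmul padd.
Proof. by move=> x y z; pauto; rewrite mulrDr. Qed.
Lemma pone_neq0 : pone != 0 :> P.
Proof.
apply/eqP => /pclassP H; have [A [rho r]] := model.
by have /eqP := H A rho r; rewrite /= oner_eq0.
Qed.

HB.instance Definition _ := GRing.Zmodule_isNzRing.Build P
  pmulA pmul1l pmul1r pmulDl pmulDr pone_neq0.

Lemma pscaleA a b (x : P) : pscale a (pscale b x) = pscale (a * b) x.
Proof. by pauto; rewrite scalerA. Qed.
Lemma pscale1 : left_id 1 pscale.
Proof. by move=> x; pauto; rewrite scale1r. Qed.
Lemma pscaleDr : right_distributive pscale +%R.
Proof. by move=> a x y; pauto; rewrite scalerDr. Qed.
Lemma pscaleDl (x : P) : {morph pscale^~ x : a b / a + b}.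
Proof. by move=> a b; pauto; rewrite scalerDl. Qed.

HB.instance Definition _ := GRing.Zmodule_isLmodule.Build K P
  pscaleA pscale1 pscaleDr pscaleDl.

Lemma pscaleAl (a : K) (x y : P) : a *: (x * y) = (a *: x) * y.
Proof. by pauto; rewrite scalerAl. Qed.
HB.instance Definition _ := GRing.Lmodule_isLalgebra.Build K P pscaleAl.

Lemma pscaleAr (a : K) (x y : P) : a *: (x * y) = x * (a *: y).
Proof. by pauto; rewrite scalerAr. Qed.
HB.instance Definition _ := GRing.Lalgebra_isAlgebra.Build K P pscaleAr.

End Presentation.

(** * Tensor product of two algebras *)

Section Tensor.
Variables (K : fieldType) (A B : algType K).

Definition bilinear_map (V : lmodType K) (f : A -> B -> V) : Prop :=
  (forall b, linear (f^~ b)) /\ (forall a, linear (f a)).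

(* [s] stands for the sum of the a (x) b, for (a, b) in [s]. *)
Definition presum (V : lmodType K) (f : A -> B -> V) (s : seq (A * B)) : V :=
  \sum_(p <- s) f p.1 p.2.

Definition tens_eq (s t : seq (A * B)) : bool :=
  `[< forall (V : lmodType K) (f : A -> B -> V), bilinear_map f ->
        presum f s = presum f t >].

Lemma tens_eq_refl : reflexive tens_eq.
Proof. by move=> t; apply/asboolP. Qed.

Lemma tens_eq_sym : symmetric tens_eq.
Proof. by move=> t u; apply/asboolP/asboolP => tu V f /tu ->. Qed.

Lemma tens_eq_trans : transitive tens_eq.
Proof.
move=> u t v /asboolP tu /asboolP uv; apply/asboolP => V f r.
by rewrite tu // uv.
Qed.

Canonical tens_eq_equiv :=
  EquivRel tens_eq tens_eq_refl tens_eq_sym tens_eq_trans.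

Definition tensor : Type := {eq_quot tens_eq}.
HB.instance Definition _ := Choice.copy tensor {eq_quot tens_eq}.

Definition tclass (s : seq (A * B)) : tensor := \pi_{eq_quot tens_eq} s.
Definition trepr (x : tensor) : seq (A * B) := generic_quotient.repr (x : {eq_quot tens_eq}).

Lemma treprK x : tclass (trepr x) = x.
Proof. exact: reprK. Qed.

Lemma tclassP s t :
  (forall (V : lmodType K) (f : A -> B -> V), bilinear_map f ->
     presum f s = presum f t) <-> tclass s = tclass t.
Proof.
split=> [tu|/eqmodP /asboolP //].
by apply/eqmodP/asboolP.
Qed.

Lemma presum_repr (V : lmodType K) (f : A -> B -> V) s : bilinear_map f ->
  presum f (trepr (tclass s)) = presum f s.
Proof. by have /tclassP := treprK (tclass s); apply. Qed.

Lemma tensP (x y : tensor) :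
  (forall (V : lmodType K) (f : A -> B -> V), bilinear_map f ->
     presum f (trepr x) = presum f (trepr y)) -> x = y.
Proof. by move=> /tclassP; rewrite !treprK. Qed.

Definition tens (a : A) (b : B) : tensor := tclass [:: (a, b)].

Definition scale_left (k : K) (s : seq (A * B)) : seq (A * B) :=
  [seq (k *: p.1, p.2) | p <- s].
Definition mul_pairs (s t : seq (A * B)) : seq (A * B) :=
  [seq (p.1 * q.1, p.2 * q.2) | p <- s, q <- t].

Definition tzero : tensor := tclass [::].
Definition tone : tensor := tens 1 1.
Definition topp (x : tensor) : tensor := tclass (scale_left (-1) (trepr x)).
Definition tadd (x y : tensor) : tensor := tclass (trepr x ++ trepr y).
Definition tscale (k : K) (x : tensor) : tensor :=
  tclass (scale_left k (trepr x)).
Definition tmul (x y : tensor) : tensor :=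
  tclass (mul_pairs (trepr x) (trepr y)).

Lemma presum_cat (V : lmodType K) (f : A -> B -> V) s t :
  presum f (s ++ t) = presum f s + presum f t.
Proof. exact: big_cat. Qed.

Lemma presum_scale (V : lmodType K) (f : A -> B -> V) k s : bilinear_map f ->
  presum f (scale_left k s) = k *: presum f s.
Proof.
move=> [fl _]; rewrite /presum big_map scaler_sumr; apply: eq_bigr => p _ /=.
have f0 : f 0 p.2 = 0.
  have := fl p.2 (-1) 0 0; rewrite scaler0 addr0 scaleN1r.
  by move=> /= ->; rewrite addNr.
by have := fl p.2 k p.1 0; rewrite /= addr0 f0 addr0.
Qed.

Lemma presum_mul (V : lmodType K) (f : A -> B -> V) s t :
  presum f (mul_pairs s t) =
  presum (fun a b => presum (fun a' b' => f (a * a') (b * b')) t) s.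
Proof.
by rewrite /presum /mul_pairs big_allpairs_dep.
Qed.

Lemma presum_mulC (V : lmodType K) (f : A -> B -> V) s t :
  presum f (mul_pairs s t) =
  presum (fun a' b' => presum (fun a b => f (a * a') (b * b')) s) t.
Proof. by rewrite presum_mul /presum exchange_big. Qed.

Lemma bilinear_mulr (V : lmodType K) (f : A -> B -> V) t : bilinear_map f ->
  bilinear_map (fun a b => presum (fun a' b' => f (a * a') (b * b')) t).
Proof.
move=> [fl fr]; split=> [b k a a'|a k b b'];
  rewrite /presum scaler_sumr -big_split; apply: eq_bigr => p _ /=.
- by rewrite mulrDl -scalerAl; exact: fl.
- by rewrite mulrDl -scalerAl; exact: fr.
Qed.

Lemma bilinear_mull (V : lmodType K) (f : A -> B -> V) t : bilinear_map f ->
  bilinear_map (fun a b => presum (fun a' b' => f (a' * a) (b' * b)) t).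
Proof.
move=> [fl fr]; split=> [b k a a'|a k b b'];
  rewrite /presum scaler_sumr -big_split; apply: eq_bigr => p _ /=.
- by rewrite mulrDr -scalerAr; exact: fl.
- by rewrite mulrDr -scalerAr; exact: fr.
Qed.

Lemma presum_mul_reprl (V : lmodType K) (f : A -> B -> V) s t :
  bilinear_map f ->
  presum f (mul_pairs (trepr (tclass s)) t) = presum f (mul_pairs s t).
Proof. by move=> fb; rewrite !presum_mul presum_repr //; exact: bilinear_mulr. Qed.

Lemma presum_mul_reprr (V : lmodType K) (f : A -> B -> V) s t :
  bilinear_map f ->
  presum f (mul_pairs s (trepr (tclass t))) = presum f (mul_pairs s t).
Proof. by move=> fb; rewrite !presum_mulC presum_repr //; exact: bilinear_mull. Qed.

Local Ltac tauto_ := apply: tensP => V f fb;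
  do ?[rewrite presum_repr // | rewrite presum_cat | rewrite presum_scale //].

Lemma taddA : associative tadd.
Proof. by move=> x y z; tauto_; rewrite addrA. Qed.
Lemma taddC : commutative tadd.
Proof. by move=> x y; tauto_; rewrite addrC. Qed.
Lemma tadd0 : left_id tzero tadd.
Proof. by move=> x; tauto_; rewrite /presum big_nil add0r. Qed.
Lemma taddN : left_inverse tzero topp tadd.
Proof. by move=> x; tauto_; rewrite scaleN1r addNr /presum big_nil. Qed.

HB.instance Definition _ :=
  GRing.isZmodule.Build tensor taddA taddC tadd0 taddN.

Lemma tscaleA a b (x : tensor) : tscale a (tscale b x) = tscale (a * b) x.
Proof. by tauto_; rewrite scalerA. Qed.
Lemma tscale1 : left_id 1 tscale.
Proof. by move=> x; tauto_; rewrite scale1r. Qed.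
Lemma tscaleDr : right_distributive tscale +%R.
Proof. by move=> a x y; tauto_; rewrite scalerDr. Qed.
Lemma tscaleDl (x : tensor) : {morph tscale^~ x : a b / a + b}.
Proof. by move=> a b; tauto_; rewrite scalerDl. Qed.

HB.instance Definition _ := GRing.Zmodule_isLmodule.Build K tensor
  tscaleA tscale1 tscaleDr tscaleDl.

Lemma tmulA : associative tmul.
Proof.
move=> x y z; tauto_; rewrite presum_mul_reprl // presum_mul_reprr //.
rewrite !presum_mul; apply: eq_bigr => p _.
by rewrite presum_mul; apply: eq_bigr => q _; apply: eq_bigr => r _; rewrite !mulrA.
Qed.
Lemma tmul1l : left_id tone tmul.
Proof.
move=> x; tauto_; rewrite presum_mul_reprl // presum_mul /presum big_seq1 /=.
by apply: eq_bigr => p _; rewrite !mul1r.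
Qed.
Lemma tmul1r : right_id tone tmul.
Proof.
move=> x; tauto_; rewrite presum_mul_reprr // presum_mulC /presum big_seq1 /=.
by apply: eq_bigr => p _; rewrite !mulr1.
Qed.
Lemma tmulDl : left_distributive tmul tadd.
Proof.
move=> x y z; tauto_; rewrite presum_mul_reprl // !presum_mul.
by rewrite presum_cat.
Qed.
Lemma tmulDr : right_distributive tmul tadd.
Proof.
move=> x y z; tauto_; rewrite presum_mul_reprr // !presum_mulC.
by rewrite presum_cat.
Qed.

HB.instance Definition _ := GRing.Zmodule_isPzRing.Build tensor
  tmulA tmul1l tmul1r tmulDl tmulDr.

End Tensor.

(* f (x) g; this is meaningful when [f] and [g] are linear. *)
Definition tens_map (K : fieldType) (A B A' B' : algType K)
    (f : A -> A') (g : B -> B') (x : tensor A B) : tensor A' B' :=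
  tclass [seq (f p.1, g p.2) | p <- trepr x].

Definition lie (K : fieldType) (A : algType K) (x y : A) : A := x * y - y * x.
Definition anti (K : fieldType) (A : algType K) (x y : A) : A := x * y + y * x.

(** * The affine Yangian *)

Section Yangian.
Variables (K : fieldType) (N : nat).
Local Notation I := 'Z_N.

Definition cartan_mx (i j : I) : int :=
  if i == j then 2 else if (i == j + 1) || (i == j - 1) then -1 else 0.

Definition shift_mx (i j : I) : int :=
  if j == i - 1 then 1 else if j == i + 1 then -1 else 0.

(* [YX true i r] and [YX false i r] are x^+_{i,r} and x^-_{i,r}. *)
Inductive ygen : Type := YX of bool & I & nat | YH of I & nat.

Definition sgn (s : bool) : K := if s then 1 else -1.

Variables eps1 eps2 : K.

Record yangian_rel (A : algType K) (rho : ygen -> A) : Prop := {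
  yrel_hh i j r s : lie (rho (YH i r)) (rho (YH j s)) = 0;
  yrel_xx i j r s : lie (rho (YX true i r)) (rho (YX false j s)) =
    if i == j then rho (YH i (r + s)%N) else 0;
  yrel_h0x e i j r : lie (rho (YH i 0)) (rho (YX e j r)) =
    (sgn e * (cartan_mx i j)%:~R) *: rho (YX e j r);
  yrel_hx e i j r s :
    lie (rho (YH i r.+1)) (rho (YX e j s))
      - lie (rho (YH i r)) (rho (YX e j s.+1)) =
    (sgn e * (cartan_mx i j)%:~R * ((eps1 + eps2) / 2%:R))
        *: anti (rho (YH i r)) (rho (YX e j s))
      - ((shift_mx i j)%:~R * ((eps1 - eps2) / 2%:R))
        *: lie (rho (YH i r)) (rho (YX e j s));
  yrel_xx1 e i j r s :
    lie (rho (YX e i r.+1)) (rho (YX e j s))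
      - lie (rho (YX e i r)) (rho (YX e j s.+1)) =
    (sgn e * (cartan_mx i j)%:~R * ((eps1 + eps2) / 2%:R))
        *: anti (rho (YX e i r)) (rho (YX e j s))
      - ((shift_mx i j)%:~R * ((eps1 - eps2) / 2%:R))
        *: lie (rho (YX e i r)) (rho (YX e j s));
  yrel_serre e i j (r : 'I_(absz (1 - cartan_mx i j)) -> nat) s : i != j ->
    \sum_(w : {perm 'I_(absz (1 - cartan_mx i j))})
      foldr (fun k z => lie (rho (YX e i (r (w k)))) z) (rho (YX e j s))
        (enum 'I_(absz (1 - cartan_mx i j))) = 0
}.

Lemma yangian_model : exists A : algType K, exists rho : ygen -> A,
  yangian_rel rho.
Proof.
exists (K^o : algType K), (fun=> 0).
have lie00 : lie (0 : (K^o : algType K)) 0 = 0 by rewrite /lie mulr0 subr0.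
have anti00 : anti (0 : (K^o : algType K)) 0 = 0 by rewrite /anti mulr0 addr0.
split=> [*|i j *|*|*|*|e i j r s _]; rewrite ?lie00 ?anti00 ?scaler0 ?subr0 //.
- by case: ifP.
- by apply: big1 => w _; elim: (enum _) => //= k l ->; exact: lie00.
Qed.

Definition yangian : Type := presented yangian_model.
HB.instance Definition _ := GRing.Algebra.on yangian.

Definition yx (e : bool) (i : I) (r : nat) : yangian :=
  pgen yangian_model (YX e i r).
Definition yh (i : I) (r : nat) : yangian := pgen yangian_model (YH i r).

Definition hbar : K := eps1 + eps2.
Definition yht1 (i : I) : yangian := yh i 1 - (hbar / 2%:R) *: yh i 0 ^+ 2.

(* exp(ad a), for a locally nilpotent ad a: the sum over n is then finite. *)
Definition exp_ad (a y : yangian) : yangian :=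
  \sum_(n \in [set: nat]) (n`!%:R : K)^-1 *: iter n (lie a) y.

Definition braid (i : I) (y : yangian) : yangian :=
  exp_ad (yx true i 0) (exp_ad (- yx false i 0) (exp_ad (yx true i 0) y)).

(** * The completed tensor square *)

Local Notation YY := (tensor yangian yangian).

Definition square (y : yangian) : YY := tens y 1 + tens 1 y.

Inductive homog : int -> YY -> Prop :=
| homog0 d : homog d 0
| homogD d u v : homog d u -> homog d v -> homog d (u + v)
| homogZ d a u : homog d u -> homog d (a *: u)
| homog1 : homog 0 1
| homogM d e u v : homog d u -> homog e v -> homog (d + e) (u * v)
| homog_xl e i r : homog (if e then -1 else 1) (tens (yx e i r) 1)
| homog_xr e i r : homog (if e then 1 else -1) (tens 1 (yx e i r))
| homog_hl i r : homog 0 (tens (yh i r) 1)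
| homog_hr i r : homog 0 (tens 1 (yh i r)).

(* A formal sum of homogeneous elements, one for each degree; the element of
   degree [d] is [F d]. *)
Definition fsum : Type := int -> YY.

Definition in_completion (F : fsum) : Prop :=
  (forall d, homog d (F d)) /\ (exists b : int, forall d, d < b -> F d = 0).

Definition is_decomposition (z : YY) (F : fsum) : Prop :=
  [/\ forall d, homog d (F d), finite_set [set d | F d != 0] &
      z = \sum_(d \in [set: int]) F d].

(* The image of Y (x) Y in its completion: the homogeneous components of [z],
   which are unique since Y (x) Y is graded. *)
Definition emb (z : YY) : fsum :=
  xget (fun=> 0) [set F : fsum | is_decomposition z F].

(* Convergence in the completion of the sum of a family of elements of
   Y (x) Y: only finitely many terms have a nonzero component in degrees at
   most [d], for any [d]. *)
Definition csummable (T : Type) (D : set T) (g : T -> YY) : Prop :=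
  forall d : int,
    finite_set [set t | D t /\ exists2 e : int, e <= d & emb (g t) e != 0].

Definition csum (T : choiceType) (D : set T) (g : T -> YY) : fsum :=
  fun d => \sum_(t \in D) emb (g t) d.

Definition cmul (F G : fsum) : fsum :=
  fun d => \sum_(e \in [set: int]) F e * G (d - e).

End Yangian.

(** * The affine Lie algebra *)

(* [al] stands for the element sum_i al_i alpha_i. *)
Notation root_lattice N := {ffun 'Z_N -> int}.

Section Affine.
Variables (K : fieldType) (N : nat).
Local Notation I := 'Z_N.
Local Notation M := 'M[K]_((Zp_trunc N).+2).

(* ((X, a), b) stands for sum_n X_n t^n + a c + b d, with X_n of size N and
   rows and columns indexed by Z/N (N >= 2). *)
Local Notation aff_raw := ((int -> M) * K^o * K^o)%type.

Definition aff_pred : {pred aff_raw} := fun x =>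
  `[< finite_set [set n | x.1.1 n != 0] /\ forall n, \tr (x.1.1 n) = 0 >].

Lemma aff_pred_submod : submod_closed aff_pred.
Proof.
split.
  apply/asboolP; split=> [|n]; last exact: mxtrace0.
  rewrite [X in finite_set X](_ : _ = set0) //.
  by apply/seteqP; split=> n //=; rewrite eqxx.
move=> a x y /asboolP [fx tx] /asboolP [fy ty]; apply/asboolP; split=> [|n].
  apply: (@sub_finite_set _ _
    ([set n | x.1.1 n != 0] `|` [set n | y.1.1 n != 0])); last first.
    by rewrite finite_setU.
  move=> n /= nz; have [x0|/eqP] := pselect (x.1.1 n = 0); last by left.
  right; apply: contra_neq nz => y0.
  by rewrite /= ?fctE x0 y0 scaler0 addr0.
rewrite (_ : (a *: x + y).1.1 n = a *: x.1.1 n + y.1.1 n) //.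
by rewrite mxtraceD mxtraceZ tx ty mulr0 addr0.
Qed.

HB.instance Definition _ := GRing.isSubmodClosed.Build K aff_raw aff_pred
  aff_pred_submod.

(* sl_N (x) K[t, t^-1] + K c + K d *)
Record affine_sl : Type := AffineSl {
  aff_val : aff_raw; aff_valP : aff_val \in aff_pred }.
HB.instance Definition _ := [isSub for aff_val].
HB.instance Definition _ := [Choice of affine_sl by <:].
HB.instance Definition _ := [SubChoice_isSubLmodule of affine_sl by <:].

Definition loop (x : affine_sl) (n : int) : M := (aff_val x).1.1 n.
Definition d_coef (x : affine_sl) : K := (aff_val x).2.

(* [X t^m, Y t^n] = [X, Y] t^(m+n) + m delta_(m+n,0) tr(XY) c,
   [d, X t^n] = n X t^n, c central. *)
Definition aff_br_raw (x y : affine_sl) : aff_raw :=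
  (fun n => \sum_(m \in [set: int])
              (loop x m *m loop y (n - m) - loop y (n - m) *m loop x m)
            + (d_coef x * n%:~R) *: loop y n - (d_coef y * n%:~R) *: loop x n,
   \sum_(m \in [set: int]) m%:~R * \tr (loop x m *m loop y (- m)),
   0).

Lemma aff_br_subproof x y : aff_br_raw x y \in aff_pred.
Proof.
have /asboolP [] := aff_valP x; have /asboolP [] := aff_valP y.
rewrite -/(loop x) -/(loop y) => fy ty fx tx.
apply/asboolP; split=> [|n]; last first.
  rewrite /= -scaleN1r !(mxtraceD, mxtraceZ) tx ty !mulr0 !addr0.
  apply: (big_ind (fun X : M => \tr X = 0)) => [|X Z X0 Z0|m _].
  - exact: mxtrace0.
  - by rewrite mxtraceD X0 Z0 addr0.
  - by rewrite -scaleN1r mxtraceD mxtraceZ mxtrace_mulC mulN1r subrr.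
pose S : set int :=
  [set p.1 + p.2 | p in [set n | loop x n != 0] `*` [set n | loop y n != 0]]
  `|` ([set n | loop x n != 0] `|` [set n | loop y n != 0]).
apply: (@sub_finite_set _ _ S); last first.
  rewrite /S !finite_setU; split; last by split.
  by apply: finite_image; exact: finite_setX.
move=> n /= nz.
have [x0|/eqP] := pselect (loop x n = 0); last by right; left.
have [y0|/eqP] := pselect (loop y n = 0); last by right; right.
left; apply: contrapT => nex; move: nz; apply/negP; rewrite negbK; apply/eqP.
rewrite /= x0 y0 !scaler0 subr0 addr0; apply: big1 => m _.
have [->|/eqP xm] := pselect (loop x m = 0); first by rewrite mul0mx mulmx0 subr0.
have [->|/eqP ym] := pselect (loop y (n - m) = 0).
  by rewrite mul0mx mulmx0 subr0.
by exfalso; apply: nex; exists (m, n - m) => //=; rewrite addrC subrK.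
Qed.

Definition aff_br (x y : affine_sl) : affine_sl :=
  AffineSl (aff_br_subproof x y).

(* The affine Lie algebra without the degree operator. *)
Definition no_d (x : affine_sl) : Prop := d_coef x = 0.

Definition pure_loop (X : M) (n : int) : aff_raw :=
  (fun m => if m == n then X else 0, 0, 0).

Lemma pure_loop_subproof (i j : I) n : i != j ->
  pure_loop (delta_mx i j) n \in aff_pred.
Proof.
move=> ij; apply/asboolP; split=> [|m] /=.
  apply: (@sub_finite_set _ _ [set n]); last exact: finite_set1.
  by move=> m /=; case: ifP => [/eqP //|_]; rewrite eqxx.
case: ifP => _; last exact: mxtrace0.
rewrite /mxtrace big1 // => k _; rewrite mxE.
by case: eqP => //= ->; case: eqP => //= e; rewrite e eqxx in ij.
Qed.

Lemma pred_neq (i : I) : i - 1 != i.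
Proof. by rewrite -subr_eq0 addrAC subrr sub0r oppr_eq0 oner_eq0. Qed.

Lemma neq_pred (i : I) : i != i - 1.
Proof. by rewrite eq_sym pred_neq. Qed.

(* Chevalley generators: e_i = E_{i-1,i} for i != 0 and e_0 = E_{N-1,0} t;
   f_i = E_{i,i-1} for i != 0 and f_0 = E_{0,N-1} t^-1. *)
Definition aff_e (i : I) : affine_sl :=
  AffineSl (pure_loop_subproof (if i == 0 then 1 else 0) (pred_neq i)).

Definition aff_f (i : I) : affine_sl :=
  AffineSl (pure_loop_subproof (if i == 0 then -1 else 0) (neq_pred i)).

Definition aff_h (i : I) : affine_sl := aff_br (aff_e i) (aff_f i).

Lemma aff_d_subproof : ((fun=> 0, 0, 1) : aff_raw) \in aff_pred.
Proof.
apply/asboolP; split=> [|m] /=; last exact: mxtrace0.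
apply: (@sub_finite_set _ _ set0); last exact: finite_set0.
by move=> m /=; rewrite eqxx.
Qed.

Definition aff_d : affine_sl := AffineSl aff_d_subproof.

Definition cartan (t : affine_sl) : Prop :=
  (forall n, n != 0 -> loop t n = 0) /\ is_diag_mx (loop t 0).

(* The simple roots, as linear forms on the Cartan subalgebra. *)
Definition simple_root (i : I) (t : affine_sl) : K :=
  loop t 0 (i - 1) (i - 1) - loop t 0 i i + (if i == 0 then d_coef t else 0).

Local Notation root_lattice := (root_lattice N).

Definition alpha (i : I) : root_lattice := [ffun j => (j == i)%:R].

Definition root_space (al : root_lattice) (x : affine_sl) : Prop :=
  forall t, cartan t ->
    aff_br t x = (\sum_i (al i)%:~R * simple_root i t) *: x.

Definition is_root (al : root_lattice) : Prop :=
  al != 0 /\ exists2 x, root_space al x & x != 0.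

Definition positive_root (al : root_lattice) : Prop :=
  is_root al /\ forall i, 0 <= al i.

Definition is_basis (V : affine_sl -> Prop) m (v : 'I_m -> affine_sl) : Prop :=
  (forall k, V (v k)) /\
  forall x, V x -> exists! c : {ffun 'I_m -> K}, x = \sum_k c k *: v k.

Record normalized_form (B : affine_sl -> affine_sl -> K) : Prop := {
  form_linear a x y z : B (a *: x + y) z = a * B x z + B y z;
  form_sym x y : B x y = B y x;
  form_inv x y z : B (aff_br x y) z = B x (aff_br y z);
  form_nondeg x : (forall y, B x y = 0) -> x = 0;
  form_ef i : B (aff_e i) (aff_f i) = 1
}.

(* [u] and [u'] are the bases u_k and u^k. *)
Record cartan_dual_bases (B : affine_sl -> affine_sl -> K) m
    (u u' : 'I_m -> affine_sl) : Prop := {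
  dual_basisl : is_basis cartan u;
  dual_basisr : is_basis cartan u';
  dual_pairing k l : B (u k) (u' l) = (k == l)%:R
}.

(* [xr al k], for k < [mult al], is the root vector x_al^(k+1). *)
Record root_vectors (B : affine_sl -> affine_sl -> K)
    (mult : root_lattice -> nat) (xr : root_lattice -> nat -> affine_sl) :
    Prop := {
  rv_basis al : is_root al ->
    is_basis (root_space al) (fun k : 'I_(mult al) => xr al k);
  rv_dual al k l : is_root al -> (k < mult al)%N -> (l < mult (- al))%N ->
    B (xr al k) (xr (- al) l) = (k == l)%:R;
  rv_e i : xr (alpha i) 0 = aff_e i;
  rv_f i : xr (- alpha i) 0 = aff_f i
}.

(* The terms of Omega_+: those of the Cartan part, then those of the roots. *)
Section Omega.
Variables (m : nat) (u u' : 'I_m -> affine_sl).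
Variables (mult : root_lattice -> nat) (xr : root_lattice -> nat -> affine_sl).

Definition omega_index : choiceType := ('I_m + root_lattice * nat)%type.

Definition omega_dom : set omega_index := [set s |
  match s with
  | inl _ => True
  | inr (al, k) => positive_root al /\ (k < mult al)%N
  end].

Definition omega_l (s : omega_index) : affine_sl :=
  match s with inl k => u' k | inr (al, k) => xr (- al) k end.
Definition omega_r (s : omega_index) : affine_sl :=
  match s with inl k => u k | inr (al, k) => xr al k end.
End Omega.

End Affine.

(** * The coproduct *)

Section Coproduct.
Variables (K : fieldType) (N : nat) (eps1 eps2 : K).
Local Notation I := 'Z_N.
Local Notation g := (affine_sl K N).
Local Notation Y := (yangian N eps1 eps2).
Local Notation hb := (hbar eps1 eps2).

(* The identification of the Lie algebra (without d) with its image in Y.  It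
   is extended to d by 0; this value plays no role, since the commutators
   below do not involve d. *)
Record chevalley_embedding (iota : {linear g -> Y}) : Prop := {
  iota_br x y : no_d x -> no_d y ->
    iota (aff_br x y) = lie (iota x) (iota y);
  iota_e i : iota (aff_e K i) = yx eps1 eps2 true i 0;
  iota_f i : iota (aff_f K i) = yx eps1 eps2 false i 0;
  iota_h i : iota (aff_h K i) = yh eps1 eps2 i 0;
  iota_d : iota (aff_d K N) = 0
}.

Section WithOmega.
Variables (iota : {linear g -> Y}) (m : nat) (u u' : 'I_m -> g).
Variables (mult : root_lattice N -> nat) (xr : root_lattice N -> nat -> g).
Local Notation om_l := (omega_l u' xr).
Local Notation om_r := (omega_r u xr).

(* [x (x) 1, Omega_+] and [1 (x) x, Omega_+] *)
Definition comm_omega_l (x : g) : fsum N eps1 eps2 :=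
  csum (omega_dom K mult)
    (fun s : omega_index N m => tens (iota (aff_br x (om_l s))) (iota (om_r s))).
Definition comm_omega_r (x : g) : fsum N eps1 eps2 :=
  csum (omega_dom K mult)
    (fun s : omega_index N m => tens (iota (om_l s)) (iota (aff_br x (om_r s)))).

Record is_coproduct (Delta : Y -> fsum N eps1 eps2) : Prop := {
  cop_completion y : in_completion (Delta y);
  cop_linear a y z d : Delta (a *: y + z) d = a *: Delta y d + Delta z d;
  cop_one : Delta 1 = emb 1;
  cop_mul y z : Delta (y * z) = cmul (Delta y) (Delta z);
  cop_x e i : Delta (yx eps1 eps2 e i 0) = emb (square (yx eps1 eps2 e i 0));
  cop_h i : Delta (yh eps1 eps2 i 0) = emb (square (yh eps1 eps2 i 0));
  cop_xp1 i d : Delta (yx eps1 eps2 true i 1) d =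
    emb (square (yx eps1 eps2 true i 1)) d
      - hb *: comm_omega_r (aff_e K i) d;
  cop_xm1 i d : Delta (yx eps1 eps2 false i 1) d =
    emb (square (yx eps1 eps2 false i 1)) d
      + hb *: comm_omega_l (aff_f K i) d;
  cop_h1 i d : Delta (yht1 eps1 eps2 i) d =
    emb (square (yht1 eps1 eps2 i)) d
      + hb *: comm_omega_l (aff_h K i) d
}.
End WithOmega.

End Coproduct.

(* Main.v *)
(* Delta is multiplicative, and x_i^+ and x_i^- are primitive, so Delta turns
   exp(ad x) on Y into exp(ad (x (x) 1 + 1 (x) x)) on formal sums, and this is
   exp(ad x) (x) exp(ad x), since the two summands commute.  What has to be
   checked is convergence: x (x) 1 and 1 (x) x have opposite degrees, so the
   termwise action on an infinite sum is summable only if the exponentials stop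
   at an order which does not depend on the term.  Call y bounded by n if every
   word in ad x_i^+ and ad x_i^-, in which the two letters occur p and q times
   with |p - q| >= n, kills y; bounded elements form a subalgebra.  The affine
   Lie algebra is bounded by 3, because ad h_i has eigenvalues in {-2, ..., 2}
   on it, and h_{j,1} - (hbar / 2) h_j^2 is bounded because it generates, modulo
   products of elements of the sl_2 of index i, a module with weights -2, 0, 2.
   These elements generate Y, and the formulas for their coproducts show that
   the components of Delta(y) are uniformly bounded in both factors. *)
Require Import Defs.
From mathcomp Require Import all_boot all_order all_algebra.
From mathcomp Require Import all_classical reals complex zify.

Set Implicit Arguments.
Unset Strict Implicit.
Unset Printing Implicit Defensive.

Import Order.TTheory GRing.Theory Num.Theory.

Local Open Scope classical_set_scope.
Local Open Scope ring_scope.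

(** * Presented algebras and tensor products *)

Section LinearPredicate.
Variables (K : fieldType) (U V : lmodType K) (f : U -> V).
Hypothesis flin : linear f.

Lemma linD x y : f (x + y) = f x + f y.
Proof. by have := flin 1 x y; rewrite !scale1r. Qed.

Lemma lin0 : f 0 = 0.
Proof. by apply: (addrI (f 0)); rewrite -linD !addr0. Qed.

Lemma linZ a x : f (a *: x) = a *: f x.
Proof. by have := flin a x 0; rewrite !addr0 lin0 addr0. Qed.

Lemma linN x : f (- x) = - f x.
Proof. by rewrite -scaleN1r linZ scaleN1r. Qed.

Lemma linB x y : f (x - y) = f x - f y.
Proof. by rewrite linD linN. Qed.

Lemma lin_sum (T : Type) (r : seq T) (P : pred T) (F : T -> U) :
  f (\sum_(t <- r | P t) F t) = \sum_(t <- r | P t) f (F t).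
Proof. by apply: big_morph; [exact: linD|exact: lin0]. Qed.

End LinearPredicate.

Lemma lin_comp (K : fieldType) (U V W : lmodType K) (f : V -> W) (g : U -> V) :
  linear f -> linear g -> linear (f \o g).
Proof. by move=> fl gl a x y; rewrite /= gl fl. Qed.

Lemma lin_iter (K : fieldType) (V : lmodType K) (f : V -> V) n :
  linear f -> linear (iter n f).
Proof. by move=> fl; elim: n => [|n IH] a x y //=; rewrite IH fl. Qed.

(** * Commutators in an associative algebra *)

Section Lie.
Variables (K : fieldType) (A : algType K).
Implicit Types x y z : A.

Lemma lie_linear x : linear (lie x).
Proof.
by move=> a y z; rewrite /lie mulrDr mulrDl -scalerAr -scalerAl opprD addrACA
  -scalerBr.
Qed.

Lemma lieNl x y : lie (- x) y = - lie x y.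
Proof. by rewrite /lie mulNr mulrN opprK opprB addrC. Qed.

Lemma lieNr x y : lie x (- y) = - lie x y.
Proof. exact: linN (lie_linear x) y. Qed.

Lemma lie_anti x y : lie x y = - lie y x.
Proof. by rewrite /lie opprB. Qed.

Lemma lieBl x y z : lie (x - y) z = lie x z - lie y z.
Proof. by rewrite !(lie_anti _ z) (linB (lie_linear z)) opprB opprK addrC. Qed.

Lemma lieZl a x y : lie (a *: x) y = a *: lie x y.
Proof. by rewrite lie_anti linZ ?(lie_anti x) ?scalerN //; exact: lie_linear. Qed.

Lemma lieMr x y z : lie x (y * z) = lie x y * z + y * lie x z.
Proof. by rewrite /lie mulrBl mulrBr !mulrA addrA subrK. Qed.

Lemma lieMl x y z : lie (x * y) z = x * lie y z + lie x z * y.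
Proof.
by rewrite lie_anti lieMr opprD addrC !(lie_anti z) mulNr mulrN !opprK.
Qed.

Lemma lie_jacobi x y z : lie x (lie y z) = lie (lie x y) z + lie y (lie x z).
Proof.
rewrite [lie y z]/lie (linB (lie_linear x)) !lieMr.
rewrite [lie (lie x y) z]/lie [lie y (lie x z)]/lie.
by rewrite [lie x z * y + _]addrC opprD addrACA.
Qed.

End Lie.

Section PresentedAlgebra.
Variables (K : fieldType) (G : Type).
Variable rel : forall A : algType K, (G -> A) -> Prop.
Variable model : exists A : algType K, exists rho : G -> A, rel rho.
Local Notation P := (presented model).

(** This turns induction on terms into induction on elements: every element is the value of a term
    on the generators of the presented algebra itself. *)
Lemma teval_pgen (t : term K G) : teval (pgen model : G -> P) t = pclass model t.
Proof.
elim: t => //=.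
- by move=> t ->; apply: peqP => A rho r; rewrite !prepr_pclass //= prepr_pclass.
- by move=> t -> u ->; apply: peqP => A rho r; rewrite !prepr_pclass //= !prepr_pclass.
- by move=> t -> u ->; apply: peqP => A rho r; rewrite !prepr_pclass //= !prepr_pclass.
- by move=> a t ->; apply: peqP => A rho r; rewrite !prepr_pclass //= !prepr_pclass.
Qed.

Lemma presented_ind (Q : P -> Prop) :
  (forall a y z, Q y -> Q z -> Q (a *: y + z)) -> Q 1 ->
  (forall y z, Q y -> Q z -> Q (y * z)) -> (forall g, Q (pgen model g)) ->
  forall y, Q y.
Proof.
move=> QL Q1 QM QG y; rewrite -(preprK y) -teval_pgen.
(* Closure is given only for combinations [a *: y + z], so zero is obtained as [(-1) *: 1 + 1]. *)
have Q0 : Q 0 by rewrite -(subrr 1) addrC -scaleN1r; exact: QL.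
have QZ a z : Q z -> Q (a *: z) by move=> ?; rewrite -[_ *: _]addr0; exact: QL.
elim: (prepr y) => //=.
- by move=> t Qt; rewrite -scaleN1r; exact: QZ.
- by move=> t Qt u Qu; rewrite -[X in X + _]scale1r; exact: QL.
- by move=> t Qt u Qu; exact: QM.
- by move=> a t Qt; exact: QZ.
Qed.

Section Lift.
Variables (A : algType K) (rho : G -> A).
Hypothesis r : rel rho.

Definition plift (y : P) : A := teval rho (prepr y).

Lemma plift_linear : linear plift.
Proof. by move=> a y z; rewrite /plift !prepr_pclass //= !prepr_pclass. Qed.

Lemma plift_gen g : plift (pgen model g) = rho g.
Proof. by rewrite /plift prepr_pclass. Qed.

Lemma plift1 : plift 1 = 1.
Proof. by rewrite /plift prepr_pclass. Qed.

Lemma pliftM y z : plift (y * z) = plift y * plift z.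
Proof. by rewrite /plift prepr_pclass. Qed.

Lemma plift_lie y z : plift (lie y z) = lie (plift y) (plift z).
Proof. by rewrite (linB plift_linear) !pliftM. Qed.

Lemma plift_anti y z : plift (anti y z) = anti (plift y) (plift z).
Proof. by rewrite (linD plift_linear) !pliftM. Qed.

End Lift.

Lemma plift_inj (y z : P) :
  (forall (A : algType K) (rho : G -> A), rel rho -> plift rho y = plift rho z) ->
  y = z.
Proof. exact: peqP. Qed.

End PresentedAlgebra.

(** * Calculus in tensor products, through bilinear maps *)

Section TensorTheory.
Variables (K : fieldType) (A B : algType K).
Implicit Types (a : A) (b : B) (x y : tensor A B).

Lemma presum_reprD (V : lmodType K) (f : A -> B -> V) x y : bilinear_map f ->
  presum f (trepr (x + y)) = presum f (trepr x) + presum f (trepr y).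
Proof. by move=> fb; rewrite [x + y]/(tadd x y) presum_repr // presum_cat. Qed.

Lemma presum_reprZ (V : lmodType K) (f : A -> B -> V) k x : bilinear_map f ->
  presum f (trepr (k *: x)) = k *: presum f (trepr x).
Proof.
by move=> fb; rewrite [k *: x]/(tscale k x) presum_repr // presum_scale.
Qed.

Lemma presum_reprM (V : lmodType K) (f : A -> B -> V) x y : bilinear_map f ->
  presum f (trepr (x * y)) = presum f (mul_pairs (trepr x) (trepr y)).
Proof. by move=> fb; rewrite [x * y]/(tmul x y) presum_repr. Qed.

Lemma presum_tens (V : lmodType K) (f : A -> B -> V) a b : bilinear_map f ->
  presum f (trepr (tens a b)) = f a b.
Proof. by move=> fb; rewrite presum_repr // /presum big_seq1. Qed.

Lemma tens_bilinear : bilinear_map (@tens K A B).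
Proof.
split=> [b k a a'|a k b b'] /=; apply: tensP => V f fb;
  have [fl fr] := fb; rewrite presum_reprD // presum_reprZ // !presum_tens //;
  [exact: fl|exact: fr].
Qed.

Lemma tens_linl b : linear (@tens K A B ^~ b).
Proof. exact: tens_bilinear.1. Qed.

Lemma tens_linr a : linear (@tens K A B a).
Proof. exact: tens_bilinear.2. Qed.

Lemma tens0l b : tens (0 : A) b = 0.
Proof. exact: lin0 (tens_linl b). Qed.

Lemma tens0r a : tens a (0 : B) = 0.
Proof. exact: lin0 (tens_linr a). Qed.

Lemma tens_mul a b a' b' : tens a b * tens a' b' = tens (a * a') (b * b').
Proof.
apply: tensP => V f fb; rewrite presum_reprM // presum_tens //.
by rewrite presum_mul_reprl // presum_mul_reprr // /presum !big_seq1.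
Qed.

Lemma tens_expand x : x = \sum_(p <- trepr x) tens p.1 p.2.
Proof.
apply: tensP => V f fb.
have E s : presum f (trepr (\sum_(p <- s) tens p.1 p.2 : tensor A B)) =
    presum f s.
  elim: s => [|p s IH].
    by rewrite big_nil [0]/(tzero A B) presum_repr.
  by rewrite big_cons presum_reprD // IH presum_tens // /presum big_cons.
by rewrite E.
Qed.

(** Pure tensors absorb scalars, so closure under sums is enough. *)
Lemma tensor_ind (Q : tensor A B -> Prop) : Q 0 ->
  (forall x y, Q x -> Q y -> Q (x + y)) -> (forall a b, Q (tens a b)) ->
  forall x, Q x.
Proof.
by move=> Q0 QD QT x; rewrite (tens_expand x); apply: (big_ind Q).
Qed.

Lemma tensor_scaleAl k x y : k *: (x * y) = (k *: x) * y.
Proof.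
apply: tensP => V f fb; rewrite presum_reprZ // !presum_reprM //.
by rewrite !presum_mul presum_reprZ //; exact: bilinear_mulr.
Qed.

Lemma tensor_scaleAr k x y : k *: (x * y) = x * (k *: y).
Proof.
apply: tensP => V f fb; rewrite presum_reprZ // !presum_reprM //.
by rewrite !presum_mulC presum_reprZ //; exact: bilinear_mull.
Qed.

End TensorTheory.

Section TensorMap.
Variables (K : fieldType) (A B A' B' : algType K).

Lemma tens_mapE (f : A -> A') (g : B -> B') (x : tensor A B) :
  tens_map f g x = presum (fun a b => tens (f a) (g b)) (trepr x).
Proof.
pose F a b := tens (f a) (g b); rewrite /tens_map -/F.
elim: (trepr x) => [|p s IH] /=; first by rewrite /presum big_nil.
rewrite [RHS]big_cons -[X in _ + X]/(presum F s) -IH; apply: tensP => V h hb.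
rewrite presum_reprD // presum_tens // !presum_repr //.
by rewrite /presum big_cons.
Qed.

Variables (f : A -> A') (g : B -> B').
Hypotheses (flin : linear f) (glin : linear g).

Let fg_bilinear : bilinear_map (fun a b => tens (f a) (g b)).
Proof.
split=> [b k a a'|a k b b'] /=.
- by rewrite flin tens_linl.
- by rewrite glin tens_linr.
Qed.

Lemma tens_map_tens a b : tens_map f g (tens a b) = tens (f a) (g b).
Proof. by rewrite tens_mapE presum_tens. Qed.

Lemma tens_map_linear : linear (tens_map f g).
Proof. by move=> k x y; rewrite !tens_mapE presum_reprD // presum_reprZ. Qed.

End TensorMap.

Lemma tens_map_comp (K : fieldType) (A A1 A2 : algType K)
    (f : A1 -> A2) (g : A -> A1) (x : tensor A A) :
  linear f -> linear g ->
  tens_map (f \o g) (f \o g) x = tens_map f f (tens_map g g x).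
Proof.
move=> fl gl.
have fgl := lin_comp fl gl.
apply: (tensor_ind (Q := fun x => tens_map (f \o g) (f \o g) x =
  tens_map f f (tens_map g g x))) => [|y z IHy IHz|a b].
- by rewrite !(lin0 (tens_map_linear _ _)).
- by rewrite !(linD (tens_map_linear _ _)) // IHy IHz.
- by rewrite !tens_map_tens.
Qed.

(** * Generators and grading of the Yangian *)

Section YangianTheory.
Variables (K : numFieldType) (N : nat) (eps1 eps2 : K).
Local Notation Y := (yangian N eps1 eps2).
Local Notation X := (yx eps1 eps2).
Local Notation H := (yh eps1 eps2).
Local Notation hb := (hbar eps1 eps2).

(** An equality in the presented algebra may be tested in every algebra with a family satisfying the
    relations; there, each relation holds by assumption. *)
Lemma yangian_relP :
  yangian_rel eps1 eps2 (pgen (yangian_model N eps1 eps2)).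
Proof.
split=> [*|*|*|*|*|e i j k s ij]; apply: plift_inj => A rho r.
- by rewrite plift_lie // !plift_gen // (yrel_hh r) (lin0 (plift_linear r)).
- rewrite plift_lie // !plift_gen // (yrel_xx r); case: ifP => _.
    by rewrite plift_gen.
  by rewrite (lin0 (plift_linear r)).
- by rewrite (linZ (plift_linear r)) plift_lie // !plift_gen // (yrel_h0x r).
- rewrite [LHS](linB (plift_linear r)) [RHS](linB (plift_linear r)).
  rewrite !(linZ (plift_linear r)) plift_anti //.
  by rewrite !plift_lie // !plift_gen // (yrel_hx r).
- rewrite [LHS](linB (plift_linear r)) [RHS](linB (plift_linear r)).
  rewrite !(linZ (plift_linear r)) plift_anti //.
  by rewrite !plift_lie // !plift_gen // (yrel_xx1 r).
- rewrite (lin_sum (plift_linear r)) (lin0 (plift_linear r)).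
  rewrite -[RHS](yrel_serre r e k s ij); apply: eq_bigr => w _.
  by elim: (enum _) => [|m l IH] /=; rewrite ?plift_gen // plift_lie // IH plift_gen.
Qed.

Section Rescaling.
Variable c : K.
Hypothesis c0 : c != 0.

Definition rescaled_gen (g : ygen N) : Y :=
  match g with
  | YX s i r => (if s then c else c^-1) *: X s i r
  | YH i r => H i r
  end.

(** All relations are homogeneous when [x^+], [x^-] and [h] have degrees 1, -1 and 0, so both sides
    are multiplied by the same power of [c]. *)
Lemma rescaled_rel : yangian_rel eps1 eps2 rescaled_gen.
Proof.
have lieZr a (x y : Y) : lie x (a *: y) = a *: lie x y.
  exact: linZ (lie_linear x) a y.
have antiZr a (x y : Y) : anti x (a *: y) = a *: anti x y.
  by rewrite /anti -scalerAr -scalerAl scalerDr.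
have antiZl a (x y : Y) : anti (a *: x) y = a *: anti x y.
  by rewrite /anti -scalerAr -scalerAl scalerDr.
split=> /=.
- exact: (yrel_hh yangian_relP).
- move=> i j r s; rewrite lieZr lieZl scalerA mulVf // scale1r.
  exact: (yrel_xx yangian_relP).
- move=> e i j r; rewrite lieZr (yrel_h0x yangian_relP) !scalerA.
  by rewrite [X in X *: _]mulrC.
- move=> e i j r s; rewrite !lieZr antiZr -scalerBr (yrel_hx yangian_relP).
  by rewrite scalerBr !scalerA ![(if e then _ else _) * _]mulrC.
- move=> e i j r s; rewrite !lieZr antiZr !lieZl antiZl.
  rewrite !(scalerA _ _ (lie _ _)) -scalerBr (yrel_xx1 yangian_relP).
  set a := if e then _ else _.
  by rewrite scalerBr !scalerA ![a * a * _]mulrC !mulrA.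
- move=> e i j r s ij; set a := if e then _ else _; set l := enum _.
  have E (f : 'I_(absz (1 - cartan_mx i j)) -> nat) :
      foldr (fun k z => lie (a *: X e i (f k)) z) (a *: X e j s) l =
      a ^+ (size l).+1 *: foldr (fun k z => lie (X e i (f k)) z) (X e j s) l.
    elim: l => [|k l IH] /=; first by rewrite expr1.
    by rewrite IH lieZl lieZr scalerA -exprS.
  under eq_bigr => w _ do rewrite E.
  by rewrite -scaler_sumr (yrel_serre yangian_relP) // scaler0.
Qed.

Definition rescale : Y -> Y := plift rescaled_gen.

Lemma rescale_linear : linear rescale.
Proof. exact: plift_linear rescaled_rel. Qed.

Lemma rescale1 : rescale 1 = 1.
Proof. exact: plift1 rescaled_rel. Qed.

Lemma rescaleM y z : rescale (y * z) = rescale y * rescale z.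
Proof. exact: pliftM rescaled_rel y z. Qed.

Lemma rescale_x s i r : rescale (X s i r) = (if s then c else c^-1) *: X s i r.
Proof. by rewrite /rescale {1}/yx plift_gen //; exact: rescaled_rel. Qed.

Lemma rescale_h i r : rescale (H i r) = H i r.
Proof. by rewrite /rescale {1}/yh plift_gen //; exact: rescaled_rel. Qed.

End Rescaling.

(** The elements [x_{j,0}] and [yht1 j] generate: [h_{j,r}] is the commutator of [x^+_{j,r}] and
    [x^-_{j,0}], and [x_{j,r+1}] is recovered from the commutator of [h_{j,1}] and [x_{j,r}] because
    [a_jj = 2] is invertible. *)
Lemma yangian_ind (Q : Y -> Prop) :
  (forall a y z, Q y -> Q z -> Q (a *: y + z)) -> Q 1 ->
  (forall y z, Q y -> Q z -> Q (y * z)) ->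
  (forall s i, Q (X s i 0)) -> (forall i, Q (yht1 eps1 eps2 i)) ->
  forall y, Q y.
Proof.
move=> QL Q1 QM Qx Qh.
have Q0 : Q 0 by rewrite -(subrr 1) addrC -scaleN1r; exact: QL.
have QZ a z : Q z -> Q (a *: z) by move=> ?; rewrite -[_ *: _]addr0; exact: QL.
have QD y z : Q y -> Q z -> Q (y + z).
  by move=> ? ?; rewrite -[y]scale1r; exact: QL.
have QB y z : Q y -> Q z -> Q (y - z).
  by move=> ? ?; rewrite addrC -scaleN1r; exact: QL.
have Qlie y z : Q y -> Q z -> Q (lie y z) by move=> ? ?; apply: QB; exact: QM.
have Qanti y z : Q y -> Q z -> Q (anti y z) by move=> ? ?; apply: QD; exact: QM.
have hE (i : 'Z_N) r : H i r = lie (X true i r) (X false i 0).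
  by have := yrel_xx yangian_relP i i r 0; rewrite eqxx addn0 => /esym.
have Qh0 i : Q (H i 0) by rewrite hE; exact: Qlie.
have Qh1 i : Q (H i 1).
  have -> : H i 1 = yht1 eps1 eps2 i + (hb / 2%:R) *: H i 0 ^+ 2.
    by rewrite /yht1 subrK.
  by apply: QD => //; apply: QZ; rewrite expr2; exact: QM.
have Qxr s i r : Q (X s i r).
  elim: r => // r IH.
  have := yrel_hx yangian_relP s i i 0 r.
  set a := (_ * _ * _ : K); set b := (_ * _ : K).
  have /= -> := yrel_h0x yangian_relP s i i r.+1.
  set q := (_ * _ : K) => E.
  have q0 : q != 0.
    rewrite /q /cartan_mx eqxx mulf_neq0 ?intr_eq0 //.
    by case: (s); rewrite /= ?oppr_eq0 oner_eq0.
  have -> : X s i r.+1 = q^-1 *: (lie (H i 1) (X s i r) -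
      (a *: anti (H i 0) (X s i r) - b *: lie (H i 0) (X s i r))).
    by rewrite [X in _ - X](esym E) opprB addrC subrK scalerA mulVf ?scale1r.
  apply: (QZ); apply: (QB); first exact: Qlie.
  by apply: QB; apply: QZ; [exact: Qanti|exact: Qlie].
apply: presented_ind => // -[s i r|i r]; first exact: Qxr.
by rewrite -[pgen _ _]/(H i r) hE; exact: Qlie.
Qed.

End YangianTheory.

(** * Sums with finite support *)

Section FiniteSums.
Variables (T : choiceType) (V : zmodType).
Implicit Types f : T -> V.

Lemma fsumE (s : seq T) f : uniq s -> (forall t, t \notin s -> f t = 0) ->
  \sum_(t \in [set: T]) f t = \sum_(t <- s) f t.
Proof.
move=> us fs; rewrite (fsbigE s) //; last by move=> t _ /fs.
by apply: eq_bigl => t; rewrite mem_set.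
Qed.

Lemma finite_support_seq f : finite_set [set t | f t != 0] ->
  exists s : seq T, forall t, t \notin s -> f t = 0.
Proof.
move=> /finite_seqP [s E]; exists s => t ts.
apply/eqP; apply: contraNT ts => ft.
by have : [set` s] t by rewrite -E.
Qed.

Lemma seq_finite_support f (s : seq T) : (forall t, t \notin s -> f t = 0) ->
  finite_set [set t | f t != 0].
Proof.
move=> fs; apply: (@sub_finite_set _ _ [set` s]); last exact: finite_seq.
by move=> t /=; apply: contraNT => /fs ->.
Qed.

End FiniteSums.

(** * Uniqueness of homogeneous components *)

Section Grading.
Variables (K : numFieldType) (N : nat) (eps1 eps2 : K).
Local Notation Y := (yangian N eps1 eps2).
Local Notation YY := (tensor Y Y).

(* This multiplies the elements of degree [d] by [2 ^ d], which separates the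
   degrees. *)
Definition degree_scaling : YY -> YY :=
  tens_map (@rescale K N eps1 eps2 2^-1) (@rescale K N eps1 eps2 2).

Let two_neq0 : 2 != 0 :> K. Proof. by rewrite pnatr_eq0. Qed.
Let half_neq0 : 2^-1 != 0 :> K. Proof. by rewrite invr_eq0. Qed.

Lemma degree_scaling_linear : linear degree_scaling.
Proof. by apply: tens_map_linear; exact: rescale_linear. Qed.

Lemma degree_scaling_tens a b :
  degree_scaling (tens a b) = tens (rescale 2^-1 a) (rescale 2 b).
Proof. by apply: tens_map_tens; exact: rescale_linear. Qed.

Lemma degree_scalingM u v :
  degree_scaling (u * v) = degree_scaling u * degree_scaling v.
Proof.
have L := degree_scaling_linear.
apply: (tensor_ind (Q := fun u => degree_scaling (u * v) = _)) u.
- by rewrite mul0r (lin0 L) mul0r.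
- by move=> x y IHx IHy; rewrite mulrDl !(linD L) IHx IHy mulrDl.
move=> a b; apply: (tensor_ind (Q := fun v => degree_scaling (_ * v) = _)) v.
- by rewrite mulr0 (lin0 L) mulr0.
- by move=> x y IHx IHy; rewrite mulrDr !(linD L) IHx IHy mulrDr.
- by move=> a' b'; rewrite tens_mul !degree_scaling_tens !rescaleM // tens_mul.
Qed.

Lemma homog_degree d (v : YY) : homog d v -> degree_scaling v = (2 ^ d : K) *: v.
Proof.
have L := degree_scaling_linear.
elim=> {d v}.
- by move=> d; rewrite (lin0 L) scaler0.
- by move=> d u v _ IHu _ IHv; rewrite (linD L) IHu IHv scalerDr.
- by move=> d a u _ IH; rewrite (linZ L) IH !scalerA mulrC.
- by rewrite degree_scaling_tens !rescale1 // expr0z scale1r.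
- move=> d e u v _ IHu _ IHv; rewrite degree_scalingM IHu IHv expfzDr //.
  by rewrite -tensor_scaleAl -tensor_scaleAr scalerA.
- move=> e i r; rewrite degree_scaling_tens rescale1 // rescale_x //.
  by rewrite (linZ (@tens_linl _ _ _ _)); case: e; rewrite ?invrK ?exprN1 ?expr1z.
- move=> e i r; rewrite degree_scaling_tens rescale1 // rescale_x //.
  by rewrite (linZ (@tens_linr _ _ _ _)); case: e; rewrite ?exprN1 ?expr1z.
- by move=> i r; rewrite degree_scaling_tens rescale1 // rescale_h // expr0z scale1r.
- by move=> i r; rewrite degree_scaling_tens rescale1 // rescale_h // expr0z scale1r.
Qed.

(** Components of different degrees are eigenvectors of [degree_scaling] for different eigenvalues,
    hence independent. *)
Lemma homog_indep (s : seq int) (F : int -> YY) : uniq s ->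
  (forall d, homog d (F d)) -> \sum_(d <- s) F d = 0 ->
  forall d, d \in s -> F d = 0.
Proof.
have L := degree_scaling_linear.
elim: s F => // d0 s IH F /= /andP[d0s us] hF; rewrite big_cons => S0.
have Fs d : d \in s -> F d = 0.
  move=> ds; have : (2 ^ d - 2 ^ d0 : K) *: F d = 0.
    apply: (IH (fun d => (2 ^ d - 2 ^ d0 : K) *: F d)) => //.
      by move=> e; apply: homogZ.
    under eq_bigr do rewrite scalerBl -(homog_degree (hF _)).
    rewrite big_split /= sumrN -scaler_sumr -(lin_sum L).
    have -> : \sum_(d <- s) F d = - F d0 by apply/eqP; rewrite -addr_eq0 addrC S0.
    by rewrite (linN L) (homog_degree (hF d0)) scalerN opprK addNr.
  move=> /eqP; rewrite scaler_eq0 subr_eq0 => /orP[|/eqP //].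
  move=> /eqP /(congr1 ( *%R^~ (2 ^ (- d0)))).
  rewrite -!expfzDr // subrr expr0z => /eqP.
  rewrite pexprz_eq1 ?ler0n // subr_eq0 (eqr_nat _ 2 1) orbF => /eqP dd0.
  by rewrite dd0 (negbTE d0s) in ds.
move=> d; rewrite inE => /orP[/eqP ->|]; last exact: Fs.
by move: S0; rewrite big_seq big1 ?addr0.
Qed.

Lemma homogN d (v : YY) : homog d v -> homog d (- v).
Proof. by rewrite -scaleN1r; exact: homogZ. Qed.

(** Independence of degrees makes the decomposition unique, so the choice made by [xget] in [emb] is
    forced. *)
Lemma emb_decomposition z (F : fsum N eps1 eps2) :
  is_decomposition z F -> emb z = F.
Proof.
move=> zF; apply: xget_unique => // G [hG fG zG].
have [hF fF zF'] := zF.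
have [s sF] := finite_support_seq fF; have [t tG] := finite_support_seq fG.
pose r := undup (s ++ t).
have rF d : d \notin r -> F d = 0.
  by rewrite mem_undup mem_cat negb_or => /andP[/sF].
have rG d : d \notin r -> G d = 0.
  by rewrite mem_undup mem_cat negb_or => /andP[_ /tG].
have ur : uniq r := undup_uniq _.
apply/funext => d; have [dr|dr] := boolP (d \in r); last by rewrite rF ?rG.
apply/eqP; rewrite -subr_eq0; apply/eqP.
apply: (homog_indep (F := fun d => G d - F d) ur) dr => [e|].
  by apply: homogD; last exact: homogN.
by rewrite big_split /= sumrN -!fsumE // -zG -zF' subrr.
Qed.

Definition conc (d : int) (v : YY) : fsum N eps1 eps2 :=
  fun e => if e == d then v else 0.

End Grading.

(** * Bounded elements *)

Section Bounded.
Variables (K : fieldType) (V : lmodType K) (L : Type) (op : L -> V -> V).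
Variable beta : L -> int.
Hypothesis oplin : forall l, linear (op l).

(** The last letter acts first; hence the inductions on words with [rcons]. *)
Definition act (w : seq L) (v : V) : V := foldr op v w.
Definition bal (w : seq L) : int := \sum_(l <- w) beta l.

(* When [v] has weight [k] for a grading in which [op l] has weight [beta l],
   this says that the module generated by [v] lives in weights of absolute
   value less than [n]. *)
Definition bdd (n : nat) (k : int) (v : V) : Prop :=
  forall w, n%:Z <= `|k + bal w| -> act w v = 0.

Lemma act_linear w : linear (act w).
Proof. by elim: w => [|l w IH] a x y //=; rewrite IH oplin. Qed.

Lemma act_rcons w l v : act (rcons w l) v = act w (op l v).
Proof. by rewrite /act -cats1 foldr_cat. Qed.

Lemma bal_nil : bal [::] = 0.
Proof. exact: big_nil. Qed.

Lemma bal_rcons w l : bal (rcons w l) = bal w + beta l.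
Proof. by rewrite /bal -cats1 big_cat big_seq1. Qed.

Lemma bdd_lin n k a x y : bdd n k x -> bdd n k y -> bdd n k (a *: x + y).
Proof. by move=> bx bt w nw; rewrite act_linear bx // bt // scaler0 addr0. Qed.

Lemma bdd0 n k : bdd n k 0.
Proof. by move=> w _; rewrite (lin0 (act_linear w)). Qed.

Lemma bddD n k x y : bdd n k x -> bdd n k y -> bdd n k (x + y).
Proof. by move=> bx bt; rewrite -[x]scale1r; exact: bdd_lin. Qed.

Lemma bddZ n k a x : bdd n k x -> bdd n k (a *: x).
Proof.
by move=> bx; rewrite -[_ *: _]addr0; apply: bdd_lin => //; exact: bdd0.
Qed.

Lemma bdd_sum (T : eqType) (r : seq T) n k (F : T -> V) :
  (forall t, t \in r -> bdd n k (F t)) -> bdd n k (\sum_(t <- r) F t).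
Proof.
by move=> bF; rewrite big_seq; apply: big_ind => //; [exact: bdd0|exact: bddD].
Qed.

Lemma bdd_le n p k v : (n <= p)%N -> bdd n k v -> bdd p k v.
Proof. by move=> np bv w pw; apply: bv; apply: le_trans pw; rewrite lez_nat. Qed.

Lemma bdd_shift n j k v : bdd n j v -> bdd (n + `|(j - k)%R|) k v.
Proof. by move=> bv w nw; apply: bv; move: (bal w) nw => b; lia. Qed.

Lemma bdd_op n k l v : bdd n k v -> bdd n (k + beta l) (op l v).
Proof.
move=> bv w nw; rewrite -act_rcons; apply: bv.
by rewrite bal_rcons [bal w + _]addrC addrA.
Qed.

Lemma bdd_step n k v : `|k| < n%:Z ->
  (forall l, bdd n (k + beta l) (op l v)) -> bdd n k v.
Proof.
move=> kn bv w; elim/last_ind: w => [|w l _].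
  by rewrite bal_nil addr0 leNgt kn.
by rewrite bal_rcons [bal w + _]addrC addrA act_rcons; exact: bv.
Qed.

Lemma bdd_out n k v : n%:Z <= `|k| -> bdd n k v -> v = 0.
Proof. by move=> nk /(_ [::]); rewrite bal_nil addr0; exact. Qed.

(** By the Leibniz rule a letter can be moved onto either factor, keeping the total weight. Once no
    letter is left, the triangle inequality puts one of the factors at a weight where it
    vanishes. *)
Lemma bdd_mul (mul : V -> V -> V) n p j k u v :
  (forall l x y, op l (mul x y) = mul (op l x) y + mul x (op l y)) ->
  (forall x, mul 0 x = 0) -> (forall x, mul x 0 = 0) ->
  bdd n j u -> bdd p k v -> bdd (n + p) (j + k) (mul u v).
Proof.
move=> der m0l m0r bu bv w; elim/last_ind: w j k u v bu bv => [|w l IH] j k u v bu bv.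
  rewrite bal_nil addr0 => npjk; rewrite /act /=.
  have [nj|jn] := leP n%:Z `|j|; first by rewrite (bdd_out nj bu).
  have [pk|kp] := leP p%:Z `|k|; first by rewrite (bdd_out pk bv).
  have := le_lt_trans (ler_normD j k) (ltrD jn kp).
  by rewrite ltNge -PoszD npjk.
rewrite bal_rcons => npw; rewrite act_rcons der (linD (act_linear w)).
rewrite (IH (j + beta l) k) ?(IH j (k + beta l)) ?addr0 //;
  try exact: bdd_op; by move: (bal w) (beta l) npw => b c; lia.
Qed.

Lemma bdd_iter n l v m : `|beta l| = 1 -> bdd n 0 v -> (n <= m)%N ->
  iter m (op l) v = 0.
Proof.
move=> bl bv nm.
have -> : iter m (op l) v = act (nseq m l) v by elim: (m) => //= p ->.
apply: bv; rewrite add0r /bal big_nseq.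
have -> : iter m (+%R (beta l)) 0 = beta l *+ m.
  by elim: (m) => //= p ->; rewrite mulrS.
by rewrite normrMn bl natz lez_nat.
Qed.

End Bounded.

(** * Eigenvalues of [ad h_i] on the affine Lie algebra *)

Section AffineWeights.
Variables (K : numFieldType) (N : nat).
Local Notation I := 'Z_N.
Local Notation g := (affine_sl K N).
Variable i : I.

Lemma aff_val_linear : linear (@aff_val K N).
Proof. by move=> a x y; exact: (linearP (\val : g -> _)). Qed.

Lemma loop_linear n : linear (fun x : g => loop x n).
Proof. by move=> a x y; rewrite /loop aff_val_linear. Qed.

Lemma d_coef_linear : linear (@d_coef K N : g -> K^o).
Proof. by move=> a x y; rewrite /d_coef aff_val_linear. Qed.

Lemma no_d_lin a (x y : g) : no_d x -> no_d y -> no_d (a *: x + y).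
Proof. by rewrite /no_d d_coef_linear => -> ->; rewrite scaler0 addr0. Qed.

Lemma no_d_br (x y : g) : no_d (aff_br x y). Proof. by []. Qed.

Lemma loop_br (x y : g) n : no_d x -> no_d y -> loop (aff_br x y) n =
  \sum_(m \in [set: int])
    (loop x m *m loop y (n - m) - loop y (n - m) *m loop x m).
Proof.
move=> dx dy; rewrite {1}/loop /aff_br /= [d_coef x]dx [d_coef y]dy.
by rewrite !mul0r !scale0r addr0 subr0.
Qed.

(** The diagonal entries of [aff_h i]. *)
Definition coroot_weight (a : I) : int := (a == i - 1)%:R - (a == i)%:R.

Lemma loop_aff_h n : loop (aff_h K i) n =
  if n == 0 then diag_mx (\row_a (coroot_weight a)%:~R) else 0.
Proof.
set e : int := if i == 0 then 1 else 0.
have le m : loop (aff_e K i) m = if m == e then delta_mx (i - 1) i else 0 by [].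
have lf m : loop (aff_f K i) m = if m == - e then delta_mx i (i - 1) else 0.
  by rewrite /loop /= /e; case: (i == 0).
rewrite /aff_h loop_br // (fsumE (s := [:: e])) //; last first.
  by move=> m; rewrite inE le => /negbTE ->; rewrite mul0mx mulmx0 subr0.
rewrite big_seq1 le eqxx lf subr_eq addNr; case: eqP => _; last first.
  by rewrite mul0mx mulmx0 subr0.
rewrite !mul_delta_mx; apply/matrixP => a b; rewrite !mxE /coroot_weight.
case: (eqVneq a b) => [<-|ab].
  by rewrite !andbb mulr1n rmorphB /= !rmorph_nat.
have E c : (a == c) && (b == c) = false.
  by apply/negP => /andP[/eqP ac /eqP bc]; rewrite ac bc eqxx in ab.
by rewrite !E mulr0n subr0.
Qed.

Lemma loop_br_aff_h (x : g) n a b : no_d x ->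
  loop (aff_br (aff_h K i) x) n a b =
  (coroot_weight a - coroot_weight b)%:~R * loop x n a b.
Proof.
move=> dx; rewrite loop_br // (fsumE (s := [:: 0])) //; last first.
  by move=> m; rewrite inE loop_aff_h => /negbTE ->; rewrite mul0mx mulmx0 subr0.
rewrite big_seq1 loop_aff_h eqxx subr0 mul_diag_mx mul_mx_diag !mxE.
by rewrite [in RHS]rmorphB /= mulrBl [loop x n a b * _]mulrC.
Qed.

(** [aff_h] is concentrated in loop degree 0, where the factor [m] of the cocycle vanishes. *)
Lemma center_br_aff_h (x : g) : (aff_val (aff_br (aff_h K i) x)).1.2 = 0.
Proof.
rewrite /aff_br /= fsbig1 // => m _; rewrite loop_aff_h.
by case: eqP => [->|_]; rewrite ?mul0r // mul0mx mxtrace0 mulr0.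
Qed.

Definition weight_nodes : seq int := [:: -2; -1; 0; 1; 2].

Definition weight_shift (a : int) (x : g) : g :=
  aff_br (aff_h K i) x - a%:~R *: x.

Lemma no_d_weight_shift a x : no_d x -> no_d (weight_shift a x).
Proof.
by move=> dx; rewrite /weight_shift addrC -scaleNr; apply: no_d_lin.
Qed.

Lemma loop_weight_shift a (x : g) n j k : no_d x ->
  loop (weight_shift a x) n j k =
  (coroot_weight j - coroot_weight k - a)%:~R * loop x n j k.
Proof.
move=> dx; have -> : loop (weight_shift a x) n =
    loop (aff_br (aff_h K i) x) n - a%:~R *: loop x n.
  by rewrite -(linZ (loop_linear n)) -(linB (loop_linear n)).
by rewrite mxE loop_br_aff_h // !mxE [in RHS]rmorphB /= mulrBl.
Qed.

Lemma aff_weights (x : g) : no_d x -> foldr weight_shift x weight_nodes = 0.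
Proof.
move=> dx; set z := foldr _ _ _.
have d0 : d_coef z = 0 by do 5! apply: no_d_weight_shift.
have l0 n : loop z n = 0.
  apply/matrixP => j k; rewrite [RHS]mxE /z /=.
  do 5! (rewrite loop_weight_shift; last by do ? apply: no_d_weight_shift).
  (* The scalar [p] is a product over the five nodes [a] of the factors [w - a], where [w] is a
     difference of two numbers in {-1, 0, 1}; one factor is therefore zero. *)
  rewrite !mulrA -!intrM; set p := (X in X%:~R * _); suff -> : p = 0 by rewrite mul0r.
  by rewrite /p /coroot_weight; do 4! case: (_ == _).
(* The shift by [a] multiplies the central component by [- a], so the node 0 kills it. *)
have c0 : (aff_val z).1.2 = 0.
  have cS a (t : g) : (aff_val (weight_shift a t)).1.2 = - (a%:~R * (aff_val t).1.2).
    rewrite /weight_shift (linB aff_val_linear) (linZ aff_val_linear).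
    rewrite [LHS](_ : _ = (aff_val (aff_br (aff_h K i) t)).1.2
      - a%:~R * (aff_val t).1.2) //.
    by rewrite center_br_aff_h sub0r.
  have zE : z = weight_shift (-2) (weight_shift (-1) (weight_shift 0
    (weight_shift 1 (weight_shift 2 x)))) by [].
  by rewrite zE !cS mul0r oppr0 !(mulr0, oppr0).
have E : aff_val z = (fun=> 0, 0, 0).
  clearbody z; move: d0 l0 c0; rewrite /d_coef /loop.
  by case: (aff_val z) => [[l c] d] /= -> l0 ->; congr (_, _, _); apply/funext.
by apply: val_inj; exact: E.
Qed.

End AffineWeights.

(** * Boundedness of all elements of the Yangian *)

Section YangianBounded.
Variables (K : numFieldType) (N : nat) (eps1 eps2 : K).
Local Notation Y := (yangian N eps1 eps2).
Local Notation g := (affine_sl K N).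
Local Notation X := (yx eps1 eps2).
Local Notation H := (yh eps1 eps2).
Local Notation hb := (hbar eps1 eps2).
Variable i : 'Z_N.

(** The sign is included, so that [braid] is the composite of the exponentials for [true], [false]
    and [true]. *)
Definition braid_gen (s : bool) : Y := if s then X true i 0 else - X false i 0.
Definition ad_gen (s : bool) : Y -> Y := lie (braid_gen s).
(** Half the eigenvalue of [ad h_i] on [braid_gen s]. *)
Definition gen_weight (s : bool) : int := if s then 1 else -1.
Local Notation ybdd := (bdd ad_gen gen_weight).

Lemma ad_gen_linear s : linear (ad_gen s).
Proof. exact: lie_linear. Qed.

Lemma cartan_mxii : cartan_mx i i = 2.
Proof. by rewrite /cartan_mx eqxx. Qed.

Lemma shift_mxii : shift_mx i i = 0.
Proof.
rewrite /shift_mx (negbTE (neq_pred i)); case: eqP => // E.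
by have := neq_pred (i + 1); rewrite addrK -E eqxx.
Qed.

Lemma lie_h_gen s : lie (H i 0) (braid_gen s) = (2 * gen_weight s)%:~R *: braid_gen s.
Proof.
have := yrel_h0x (yangian_relP N eps1 eps2) s i i 0; rewrite cartan_mxii.
case: s => /= E; first by rewrite [LHS]E mul1r.
by rewrite lieNr [X in - X]E scalerN mulN1r rmorphM mulrN1.
Qed.

Lemma lie_h_act w y : lie (H i 0) (act ad_gen w y) =
  (2 * bal gen_weight w)%:~R *: act ad_gen w y + act ad_gen w (lie (H i 0) y).
Proof.
elim: w => [|s w IH] /=; first by rewrite bal_nil mulr0 scale0r add0r.
rewrite lie_jacobi lie_h_gen lieZl -!/(ad_gen s _) IH (linD (ad_gen_linear s)).
rewrite (linZ (ad_gen_linear s)) addrA -scalerDl -rmorphD -mulrDr.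
by rewrite /bal big_cons.
Qed.

(* A word of balance [b] maps a vector of weight [a] to one of weight
   [a + 2 * b]; both lie in {-2, ..., 2} only if [|b| <= 2]. *)
Lemma weights_bdd (U : Y -> Prop) :
  (forall s y, U y -> U (ad_gen s y)) ->
  (forall a y, U y -> U (lie (H i 0) y - a%:~R *: y)) ->
  (forall y, U y ->
     foldr (fun a z => lie (H i 0) z - a%:~R *: z) y weight_nodes = 0) ->
  forall y, U y -> ybdd 3 0 y.
Proof.
move=> Ua Uh; set D := fun (a : int) (z : Y) => _ => UD.
suff Q (l : seq int) z w : all (mem weight_nodes) l -> U z ->
    foldr D z l = 0 -> 3%:Z <= `|0 + bal gen_weight w| -> act ad_gen w z = 0.
  by move=> y Uy w; apply: (Q weight_nodes) => //; exact: UD.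
elim/last_ind: l z => [|l a IH] z.
  by move=> _ _ /= -> _; rewrite (lin0 (act_linear ad_gen_linear w)).
rewrite all_rcons => /andP[al ll] Uz.
rewrite -cats1 foldr_cat /= => Dz0 w3; set y := act ad_gen w z.
(* By induction the word annihilates [D a z], so its value [y] on [z] is an eigenvector of [ad h_i],
   with eigenvalue [a] plus twice the balance of the word. *)
have Dy : lie (H i 0) y = (2 * bal gen_weight w + a)%:~R *: y.
  have := IH _ ll (Uh a z Uz) Dz0 w3.
  rewrite (linB (act_linear ad_gen_linear w)) (linZ (act_linear ad_gen_linear w)).
  move=> /eqP; rewrite subr_eq0 => /eqP E.
  by rewrite lie_h_act E -scalerDl -rmorphD.
have Uy : U y by rewrite /y; elim: (w) => //= s v; exact: Ua.
have Dl (r : seq int) : foldr D y r =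
    (\prod_(b <- r) (2 * bal gen_weight w + a - b)%:~R) *: y.
  elim: r => [|b r IHr] /=; first by rewrite big_nil scale1r.
  rewrite IHr {1}/D (linZ (lie_linear _)) Dy big_cons !scalerA -scalerBl.
  by rewrite [in RHS]rmorphB /= mulrBl [X in X - _]mulrC.
(* The product relation for [y] forces [y = 0] unless this eigenvalue is again a node, which a
   balance of absolute value at least 3 excludes. *)
have /eqP := UD _ Uy; rewrite Dl scaler_eq0 => /orP[|/eqP //].
rewrite prodf_seq_eq0 => /hasP [b bn]; rewrite intr_eq0 => /eqP ab.
exfalso; move: (bal _ w) w3 ab al bn => c; rewrite add0r !inE => w3 ab.
by move=> /or4P[|||/orP[]] /eqP ea /or4P[|||/orP[]] /eqP eb; lia.
Qed.

(** The image of the elements without [d] is stable under the two generators and under [ad h_i], and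
    inherits the product relation of [aff_weights]. The component along [d] is split off first,
    since [iota] sends [d] to 0. *)
Lemma iota_bdd (iota : {linear g -> Y}) x :
  chevalley_embedding iota -> ybdd 3 0 (iota x).
Proof.
move=> P; have ilin : linear iota := linearP iota.
suff Q z : no_d z -> ybdd 3 0 (iota z).
  have -> : x = d_coef x *: aff_d K N + (x - d_coef x *: aff_d K N).
    by rewrite addrC subrK.
  rewrite linearP iota_d // scaler0 add0r; apply: Q.
  by rewrite /no_d (linB (@d_coef_linear K N)) (linZ (@d_coef_linear K N))
    [_ *: _]mulr1 subrr.
move=> dz; pose U (y : Y) := exists2 x, no_d x & y = iota x.
apply: (weights_bdd (U := U)); last by exists z.
- move=> s _ [t dt ->]; case: s.
    by exists (aff_br (aff_e K i) t) => //; rewrite iota_br // iota_e.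
  exists (- aff_br (aff_f K i) t); last first.
    by rewrite linearN iota_br // iota_f // /ad_gen lieNl.
  by rewrite /no_d (linN (@d_coef_linear K N)) [d_coef _]no_d_br oppr0.
- move=> a _ [t dt ->]; exists (weight_shift i a t).
    exact: no_d_weight_shift.
  by rewrite /weight_shift (linB ilin) (linZ ilin) iota_br // iota_h.
- move=> _ [t dt ->]; rewrite -[RHS](linear0 iota) -(aff_weights i dt).
  elim: weight_nodes => //= a l IH; rewrite IH /weight_shift.
  rewrite (linB ilin) (linZ ilin) iota_br ?iota_h //.
  by elim: (l) => //= b l' ?; apply: no_d_weight_shift.
Qed.

Lemma ybddM n p j k y z : ybdd n j y -> ybdd p k z -> ybdd (n + p) (j + k) (y * z).
Proof.
apply: (bdd_mul ad_gen_linear (mul := fun u v => u * v)).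
- by move=> s u v; exact: lieMr.
- exact: mul0r.
- exact: mulr0.
Qed.

Lemma ybdd1 : ybdd 1 0 1.
Proof.
move=> w; case/lastP: w => [|w s _]; first by rewrite bal_nil.
rewrite act_rcons /ad_gen /lie mulr1 mul1r subrr.
exact: lin0 (act_linear ad_gen_linear w).
Qed.

(** The correction by [h_j^2] in [yht1] contributes exactly the anticommutator term of the defining
    relation, with opposite sign. *)
Lemma ad_gen_ht j s : exists c1 c2,
  ad_gen s (yht1 eps1 eps2 j) = c1 *: X s i 1 + c2 *: X s i 0.
Proof.
set q := sgn K s * (cartan_mx j i)%:~R.
set m := (shift_mx j i)%:~R * ((eps1 - eps2) / 2).
have E : lie (yht1 eps1 eps2 j) (X s i 0) = q *: X s i 1 - (m * q) *: X s i 0.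
  have := yrel_hx (yangian_relP N eps1 eps2) s j i 0 0.
  have H0 r : lie (H j 0) (X s i r) = q *: X s i r.
    exact: yrel_h0x (yangian_relP N eps1 eps2) s j i r.
  rewrite -!/(X _ _ _) -!/(H _ _) !H0 => /eqP; rewrite subr_eq => /eqP E1.
  rewrite /yht1 lieBl E1 lieZl expr2 lieMl H0 -scalerAl -scalerAr -scalerDr.
  rewrite scalerA [_ * q]mulrC -/(anti _ _) scalerA.
  rewrite -/q -/m /hbar.
  by set A := _ *: anti _ _; rewrite [A + _]addrC addrAC addrK addrC.
case: s @q E => q E.
  by exists (- q), (m * q); rewrite /ad_gen lie_anti E opprB addrC scaleNr.
by exists q, (- (m * q)); rewrite /ad_gen lieNl -lie_anti E scaleNr.
Qed.

(** For equal indices and [r = s = 0] the left side of the relation is twice this commutator, up to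
    sign, and the anticommutator is twice a square. *)
Lemma ad_gen_x1_same s : exists c, ad_gen s (X s i 1) = c *: (X s i 0 * X s i 0).
Proof.
have := yrel_xx1 (yangian_relP N eps1 eps2) s i i 0 0.
rewrite -!/(X _ _ _) cartan_mxii shift_mxii mul0r scale0r subr0.
rewrite [lie (X s i 0) _]lie_anti opprK -mulr2n -scaler_nat /anti -mulr2n.
rewrite -scaler_nat scalerA; set c := (_ * _) => E.
have {}E : lie (X s i 1) (X s i 0) = (2^-1 * c) *: (X s i 0 * X s i 0).
  by rewrite -scalerA -E scalerA mulVf ?scale1r // pnatr_eq0.
case: s @c E => c E; last by exists (2^-1 * c); rewrite /ad_gen lieNl -lie_anti.
by exists (- (2^-1 * c)); rewrite /ad_gen lie_anti E scaleNr.
Qed.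

Lemma ad_gen_x1_opp s : ad_gen (~~ s) (X s i 1) = H i 1.
Proof.
case: s; rewrite /ad_gen /= ?lieNl -?lie_anti.
  by have := yrel_xx (yangian_relP N eps1 eps2) i i 1 0; rewrite eqxx addn0.
by have := yrel_xx (yangian_relP N eps1 eps2) i i 0 1; rewrite eqxx.
Qed.

Section WithEmbedding.
Variable iota : {linear g -> Y}.
Hypothesis iotaP : chevalley_embedding iota.

Lemma x0_bdd s j : ybdd 3 0 (X s j 0).
Proof. by case: s; rewrite -?(iota_e iotaP) -?(iota_f iotaP); exact: iota_bdd. Qed.

Lemma h0_bdd j : ybdd 3 0 (H j 0).
Proof. by rewrite -(iota_h iotaP); exact: iota_bdd. Qed.

(* The part of degree 1 of the Yangian of sl_2, in weight [2 * k]. *)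
Definition ladder (k : int) : Y :=
  if k == 0 then yht1 eps1 eps2 i else
  if k == 1 then X true i 1 else if k == -1 then X false i 1 else 0.

(** From weight 0 a step gives a multiple of [x_{i,1}] plus a multiple of [x_{i,0}]. From weight 1
    or -1, the outward step gives a multiple of the square of [x_{i,0}], and the inward step gives
    [h_{i,1}], which is [yht1] up to the square of [h_{i,0}]. The bound 8 is that of the product of
    two copies of [x_{i,0}]. *)
Lemma ladder_step s k : exists c, exists2 u,
  ad_gen s (ladder k) = c *: ladder (k + gen_weight s) + u &
  ybdd 8 (k + gen_weight s) u.
Proof.
(* Reading an element bounded by 3 in weight 0 as one of weight 1 or -1 costs 1. *)
have xb t : ybdd 4 (gen_weight t) (X t i 0).
  by have := bdd_shift (k := gen_weight t) (x0_bdd t i); case: t.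
have [->|k0] := eqVneq k 0.
  have [c1 [c2 E]] := ad_gen_ht i s; exists c1, (c2 *: X s i 0).
    by rewrite E; case: (s).
  by rewrite add0r; apply: bddZ; [exact: ad_gen_linear|apply: bdd_le (xb s)].
have [[t kE]|kn] := pselect (exists t, k = gen_weight t); last first.
  exists 0, 0; last by apply: bdd0; exact: ad_gen_linear.
  have -> : ladder k = 0.
    rewrite /ladder (negbTE k0); case: eqP => [E|_].
      by case: kn; exists true.
    by case: eqP => [E|//]; case: kn; exists false.
  by rewrite (lin0 (ad_gen_linear s)) scale0r addr0.
have Lt : ladder k = X t i 1 by rewrite kE; case: (t).
rewrite Lt; have [st|st] := eqVneq s t.
  have [c E] := ad_gen_x1_same t; exists 0, (c *: (X t i 0 * X t i 0)).
    by rewrite st E scale0r add0r.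
  rewrite st kE; apply: bddZ; first exact: ad_gen_linear.
  exact: (ybddM (xb t) (xb t)).
have -> : s = ~~ t by case: (s) (t) st => [] [].
exists 1, ((hb / 2) *: (H i 0 ^+ 2)).
  rewrite ad_gen_x1_opp scale1r kE.
  have -> : ladder (gen_weight t + gen_weight (~~ t)) = yht1 eps1 eps2 i.
    by case: (t).
  by rewrite /yht1 subrK.
have -> : k + gen_weight (~~ t) = 0 + 0 by rewrite kE; case: (t).
apply: bddZ; first exact: ad_gen_linear.
by rewrite expr2; apply: bdd_le (ybddM (h0_bdd i) (h0_bdd i)).
Qed.

(** A word maps a ladder element to a multiple of another one plus an element bounded by 8; at
    weights of absolute value at least 8 both vanish. *)
Lemma ladder_bdd k : ybdd 8 k (ladder k).
Proof.
move=> w; suff [c [u -> bu]] : exists c, exists2 u,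
    act ad_gen w (ladder k) = c *: ladder (k + bal gen_weight w) + u &
    ybdd 8 (k + bal gen_weight w) u.
  move: bu; move: (k + _) => b bu b8; rewrite (bdd_out b8 bu) addr0.
  have -> : ladder b = 0; last by rewrite scaler0.
  by rewrite /ladder; do 3! (case: eqP => [E|_]; first by rewrite E in b8).
elim: w => [|s w [c [u E bu]]] /=.
  exists 1, 0; last by apply: bdd0; exact: ad_gen_linear.
  by rewrite bal_nil !addr0 scale1r.
have [c' [u' E' bu']] := ladder_step s (k + bal gen_weight w).
have -> : k + bal gen_weight (s :: w) = k + bal gen_weight w + gen_weight s.
  by rewrite {1}/bal big_cons -/(bal _ w) addrA addrAC.
exists (c * c'), (c *: u' + ad_gen s u).
  by rewrite E ad_gen_linear E' scalerDr scalerA [RHS]addrA.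
apply: bdd_lin => //; first exact: ad_gen_linear.
exact: bdd_op.
Qed.

Lemma x1_bdd s : ybdd 8 (gen_weight s) (X s i 1).
Proof. by have := ladder_bdd (k := gen_weight s); case: s. Qed.

(** For every index [j], a single letter already leads into the span of [x_{i,1}] and [x_{i,0}], to
    which the bounds at index [i] apply. *)
Lemma ht1_bdd j : ybdd 8 0 (yht1 eps1 eps2 j).
Proof.
apply: bdd_step => // s; have [c1 [c2 ->]] := ad_gen_ht j s; rewrite add0r.
apply: bdd_lin; first exact: ad_gen_linear; first exact: x1_bdd.
apply: bddZ; first exact: ad_gen_linear.
apply: (@bdd_le _ _ _ _ _ 4) => //.
by have := bdd_shift (k := gen_weight s) (x0_bdd s i); case: s.
Qed.

Lemma yangian_bdd (y : Y) : exists n, ybdd n 0 y.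
Proof.
elim/yangian_ind: y => [a y z [n bn] [p bp]||y z [n bn] [p bp]|s j|j].
- exists (maxn n p); apply: bdd_lin; first exact: ad_gen_linear.
    by apply: bdd_le bn; exact: leq_maxl.
  by apply: bdd_le bp; exact: leq_maxr.
- by exists 1; exact: ybdd1.
- by exists (n + p)%N; rewrite -[0](addr0 0); exact: ybddM.
- by exists 3; exact: x0_bdd.
- by exists 8; exact: ht1_bdd.
Qed.

End WithEmbedding.

End YangianBounded.

(** * Exponentials *)

Section TruncatedExp.
Variable K : numFieldType.

Lemma sum_trunc (V : zmodType) m M (f : nat -> V) : (m <= M)%N ->
  (forall n, (m <= n)%N -> f n = 0) -> \sum_(n < M) f n = \sum_(n < m) f n.
Proof.
move=> mM f0; rewrite -(subnK mM); elim: (M - m)%N => [|p IH] //.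
by rewrite addSn big_ord_recr /= IH f0 ?addr0 // leq_addl.
Qed.

Lemma sum_triangle (V : zmodType) (g : nat -> nat -> V) M :
  \sum_(n < M) \sum_(k < n.+1) g k (n - k)%N =
  \sum_(k < M) \sum_(q < M - k) g k q.
Proof.
elim: M => [|M IH]; first by rewrite !big_ord0.
rewrite big_ord_recr /= IH [RHS]big_ord_recr /= subSnn big_ord1.
rewrite big_ord_recr /= subnn addrA -big_split /=; congr (_ + _).
apply: eq_bigr => k _; rewrite subSn; last exact/ltnW.
by rewrite big_ord_recr.
Qed.

Variable V : lmodType K.
Implicit Types (A B : V -> V) (v : V).

(** Divided powers, for which the binomial formula has no coefficients. *)
Definition divpow n A v : V := (n`!%:R)^-1 *: iter n A v.

(** The order is explicit, so that it can be chosen uniformly over the terms of an infinite sum. *)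
Definition texp M A v : V := \sum_(n < M) divpow n A v.

Lemma divpow_linear n A : linear A -> linear (divpow n A).
Proof.
move=> Al a x y; rewrite /divpow lin_iter // scalerDr !scalerA.
by rewrite [_ * a]mulrC.
Qed.

Lemma texp_linear M A : linear A -> linear (texp M A).
Proof.
move=> Al a x y; rewrite /texp scaler_sumr -big_split.
by apply: eq_bigr => n _; rewrite divpow_linear.
Qed.

Lemma texp_trunc m M A v : (m <= M)%N ->
  (forall n, (m <= n)%N -> iter n A v = 0) -> texp M A v = texp m A v.
Proof.
move=> mM Av; apply: (sum_trunc (f := fun n => divpow n A v) mM) => n /Av.
by rewrite /divpow => ->; rewrite scaler0.
Qed.

Lemma divpowS n A v : linear A -> A (divpow n A v) = n.+1%:R *: divpow n.+1 A v.
Proof.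
move=> Al; rewrite /divpow (linZ Al) scalerA factS natrM invfM mulrA mulfV ?mul1r //.
by rewrite pnatr_eq0.
Qed.

Lemma iter_comm n A B v : (forall x, A (B x) = B (A x)) ->
  iter n A (B v) = B (iter n A v).
Proof. by move=> AB; elim: n => //= n ->. Qed.

(** Induction through [divpowS]: the factor [n + 1] on the right side is split as [k + (n + 1 - k)],
    and the two halves come from applying [A] and [B]. *)
Lemma divpow_binomial n A B v : linear A -> linear B ->
  (forall x, A (B x) = B (A x)) ->
  divpow n (fun x => A x + B x) v =
  \sum_(k < n.+1) divpow k A (divpow (n - k) B v).
Proof.
move=> Al Bl AB; set C := fun x => _.
have Cl : linear C by move=> a x y; rewrite /C Al Bl scalerDr addrACA.
elim: n => [|n IH].
  by rewrite big_ord1 /divpow /= !scalerA invr1 mulr1.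
have n0 : n.+1%:R != 0 :> K by rewrite pnatr_eq0.
apply: (scalerI n0).
rewrite -divpowS // IH (lin_sum Cl) scaler_sumr.
pose g p q := divpow p A (divpow q B v); rewrite -/g.
under eq_bigr => k _ do
  rewrite /C divpowS // /divpow (linZ Bl) -(iter_comm _ _ AB) -[_ *: iter k A _]/(divpow k A _)
    divpowS // (linZ (divpow_linear _ Al)) -subSn ?(ltnSE (ltn_ord k)) //.
rewrite big_split /=.
under [RHS]eq_bigr => k _ do rewrite -{1}(subnKC (ltnSE (ltn_ord k))) natrD scalerDl.
rewrite big_split /= [in RHS]big_ord_recl scale0r add0r.
rewrite [X in _ = _ + X]big_ord_recr /= subnn scale0r addr0.
by congr (_ + _); apply: eq_bigr => k _.
Qed.

(** The binomial expansion runs over the triangle [p + q < M], which contains the square [p, q < m];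
    the terms outside the square vanish. *)
Lemma texpD m M A B v : linear A -> linear B ->
  (forall x, A (B x) = B (A x)) ->
  (forall p q, (m <= p)%N || (m <= q)%N -> iter p A (iter q B v) = 0) ->
  (m + m <= M)%N ->
  texp M (fun x => A x + B x) v = texp m A (texp m B v).
Proof.
move=> Al Bl AB AB0 mM; pose g p q := divpow p A (divpow q B v).
have g0 p q : (m <= p)%N || (m <= q)%N -> g p q = 0.
  by move=> pq; rewrite /g /divpow (linZ (lin_iter _ Al)) AB0 // !scaler0.
have -> : texp m A (texp m B v) = \sum_(p < m) \sum_(q < m) g p q.
  by apply: eq_bigr => p _; rewrite (lin_sum (divpow_linear _ Al)).
rewrite /texp; under eq_bigr => n _ do rewrite divpow_binomial //.
rewrite (sum_triangle g).
have mM' : (m <= M)%N by lia.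
rewrite (sum_trunc (f := fun k => \sum_(q < M - k) g k q) mM') => [|p mp].
  apply: eq_bigr => p _; apply: (sum_trunc (f := g p)) => [|q mq].
    by have := ltn_ord p; lia.
  by rewrite g0 // mq orbT.
by apply: big1 => q _; rewrite g0 // mp.
Qed.

End TruncatedExp.

(** * Bounded tensors *)

Section TensorBounded.
Variables (K : numFieldType) (N : nat) (eps1 eps2 : K).
Local Notation Y := (yangian N eps1 eps2).
Local Notation YY := (tensor Y Y).
Variable i : 'Z_N.
Local Notation bg := (@braid_gen K N eps1 eps2 i).
Local Notation adg := (@ad_gen K N eps1 eps2 i).

Definition tgen (l : bool * bool) : YY :=
  if l.1 then tens (bg l.2) 1 else tens 1 (bg l.2).
Definition tgen_degree (l : bool * bool) : int :=
  if l.1 then - gen_weight l.2 else gen_weight l.2.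
Definition ad_tens (l : bool * bool) (v : YY) : YY := tgen l * v - v * tgen l.
(** Only the letters acting on the factor [c] count ([true] is the left factor), so boundedness can
    be stated for each factor separately. *)
Definition side_weight (c : bool) (l : bool * bool) : int :=
  if l.1 == c then gen_weight l.2 else 0.
Definition side_word (c : bool) (w : seq (bool * bool)) : seq bool :=
  [seq l.2 | l <- w & l.1 == c].

Lemma ad_tens_linear l : linear (ad_tens l).
Proof.
move=> a u v; rewrite /ad_tens mulrDr mulrDl -tensor_scaleAr -tensor_scaleAl.
by rewrite opprD addrACA -scalerBr.
Qed.

Lemma ad_tensM l u v : ad_tens l (u * v) = ad_tens l u * v + u * ad_tens l v.
Proof. by rewrite /ad_tens mulrBl mulrBr !mulrA addrA subrK. Qed.

Lemma ad_tens_tens l a b : ad_tens l (tens a b) =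
  if l.1 then tens (adg l.2 a) b else tens a (adg l.2 b).
Proof.
rewrite /ad_tens /tgen; case: l.1; rewrite !tens_mul !mulr1 !mul1r.
  by rewrite -(linB (@tens_linl _ _ _ _)).
by rewrite -(linB (@tens_linr _ _ _ _)).
Qed.

Lemma act_ad_tens w a b : act ad_tens w (tens a b) =
  tens (act adg (side_word true w) a) (act adg (side_word false w) b).
Proof.
elim: w => [|[c s] w IH] //=; rewrite IH ad_tens_tens.
by case: c.
Qed.

Lemma bal_side_word c w : bal (side_weight c) w = bal gen_weight (side_word c w).
Proof.
rewrite /bal /side_word big_map big_filter /side_weight.
by rewrite [RHS]big_mkcond.
Qed.

Lemma ad_tens_comm c d s t v : c != d ->
  ad_tens (c, s) (ad_tens (d, t) v) = ad_tens (d, t) (ad_tens (c, s) v).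
Proof.
move=> cd; apply: (tensor_ind (Q := fun v => ad_tens _ (ad_tens _ v) = _)) v.
- by rewrite !(lin0 (ad_tens_linear _)).
- move=> x y IHx IHy.
  have E k l : ad_tens k (ad_tens l (x + y)) =
      ad_tens k (ad_tens l x) + ad_tens k (ad_tens l y).
    exact: (linD (lin_comp (ad_tens_linear k) (ad_tens_linear l))).
  by rewrite !E IHx IHy.
- by move=> a b; rewrite !ad_tens_tens /=; case: c d cd => [] [] //= _;
    rewrite !ad_tens_tens.
Qed.

Local Notation tbdd c n := (bdd ad_tens (side_weight c) n 0).

(** A word acts on each factor through a subword, and one vanishing factor kills the tensor. *)
Lemma tens_bdd c n a b :
  bdd adg gen_weight n 0 (if c then a else b) -> tbdd c n (tens a b).
Proof.
move=> bab w; rewrite bal_side_word => /bab; rewrite act_ad_tens.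
by case: c bab => _ ->; rewrite ?tens0l ?tens0r.
Qed.

Lemma tbddM c n p u v : tbdd c n u -> tbdd c p v -> tbdd c (n + p) (u * v).
Proof.
move=> bu bv; rewrite -[0](addr0 0).
apply: (bdd_mul ad_tens_linear (mul := fun u v => u * v)) => //.
- exact: ad_tensM.
- exact: mul0r.
- exact: mulr0.
Qed.

Lemma homog_tgen l : homog (tgen_degree l) (tgen l).
Proof.
have X1 s : homog (if s then -1 else 1) (tens (bg s) 1 : YY).
  case: s; first exact: (homog_xl _ _ true).
  rewrite /= (linN (@tens_linl _ _ _ _)); apply: homogN.
  exact: (homog_xl _ _ false).
have X2 s : homog (if s then 1 else -1) (tens 1 (bg s) : YY).
  case: s; first exact: (homog_xr _ _ true).
  rewrite /= (linN (@tens_linr _ _ _ _)); apply: homogN.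
  exact: (homog_xr _ _ false).
case: l => [[] s]; last exact: X2.
by have := X1 s; case: s.
Qed.

Lemma homog_ad_tens l d v : homog d v -> homog (tgen_degree l + d) (ad_tens l v).
Proof.
move=> hv; apply: homogD; first exact: homogM (homog_tgen l) hv.
by apply: homogN; rewrite addrC; exact: homogM hv (homog_tgen l).
Qed.

Lemma homog_act w d v : homog d v ->
  homog (bal tgen_degree w + d) (act ad_tens w v).
Proof.
move=> hv; elim: w => [|l w IH]; first by rewrite bal_nil add0r.
by rewrite /bal big_cons -addrA; exact: homog_ad_tens.
Qed.

(** A word shifts all degrees by the same amount [D], so it maps the components of [v] to
    independent elements; if their sum is zero, each of them is. The default value of [emb] is 0,
    which is bounded. *)
Lemma emb_bdd c n v d : tbdd c n v -> tbdd c n (emb v d).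
Proof.
move=> bv; rewrite /emb; case: xgetP => [F _ [hF /finite_support_seq [r rF] vF]|_];
  last by apply: bdd0; exact: ad_tens_linear.
have {rF} [s us sF] : exists2 s : seq int, uniq s &
    forall e, e \notin s -> F e = 0.
  by exists (undup r) => [|e]; rewrite ?undup_uniq // mem_undup => /rF.
have [ds|ds] := boolP (d \in s); last first.
  by rewrite sF //; apply: bdd0; exact: ad_tens_linear.
move=> w nw; pose D := bal tgen_degree w.
pose G e := act ad_tens w (F (e - D)).
have -> : act ad_tens w (F d) = G (d + D) by rewrite /G addrK.
apply: (homog_indep (s := map (+%R^~ D) s)).
- by rewrite map_inj_uniq //; exact: addIr.
- by move=> e; have := homog_act w (hF (e - D)); rewrite addrC subrK.
- rewrite big_map; under eq_bigr do rewrite /G addrK.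
  by rewrite -(lin_sum (act_linear ad_tens_linear w)) -fsumE // -vF; exact: bv.
- exact: (map_f (+%R^~ D)).
Qed.

(** Each component of [csum] is a finite sum, or 0 by convention when the support is infinite, so it
    inherits a bound common to all terms. *)
Lemma csum_bdd c n (T : choiceType) (D : set T) (f : T -> YY) d :
  (forall t, tbdd c n (f t)) -> tbdd c n (csum D f d).
Proof.
move=> bf; rewrite /csum; apply: bdd_sum => [|t _]; first exact: ad_tens_linear.
exact: emb_bdd.
Qed.

Lemma cmul_bdd c n p (F G : fsum N eps1 eps2) d :
  (forall e, tbdd c n (F e)) -> (forall e, tbdd c p (G e)) ->
  tbdd c (n + p) (cmul F G d).
Proof.
move=> bF bG; rewrite /cmul; apply: bdd_sum => [|e _]; first exact: ad_tens_linear.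
exact: tbddM.
Qed.

(** Each letter moves the weight by at most 1, and returning to weight 0 costs as much. *)
Lemma tbdd_iter c n d s v p : tbdd c n v ->
  tbdd c (n + p) (iter p (ad_tens (d, s)) v).
Proof.
move=> bv; elim: p => [|p IH]; first by rewrite addn0.
have := bdd_shift (k := 0) (bdd_op (l := (d, s)) IH); rewrite add0r /= => b w nw.
apply: b; apply: le_trans nw; rewrite lez_nat addnS.
by rewrite /side_weight /=; case: (_ == _); case: (s); rewrite /=; lia.
Qed.

Lemma tbdd_texp c n d s v p : tbdd c n v ->
  tbdd c (n + p) (texp p (ad_tens (d, s)) v).
Proof.
move=> bv; rewrite /texp; apply: bdd_sum => [|q _]; first exact: ad_tens_linear.
apply: bddZ; first exact: ad_tens_linear.
apply: bdd_le (tbdd_iter d s (p := q) bv).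
by rewrite leq_add2l; exact/ltnW.
Qed.

Lemma tbdd_iter_other c n d s v p : c != d -> tbdd c n v ->
  tbdd c n (iter p (ad_tens (d, s)) v).
Proof.
move=> cd bv; elim: p => //= p IH.
by have := bdd_op (l := (d, s)) IH; rewrite /side_weight /= eq_sym (negbTE cd) addr0.
Qed.

Lemma iter_ad_tens_eq0 c n s v p : tbdd c n v -> (n <= p)%N ->
  iter p (ad_tens (c, s)) v = 0.
Proof.
move=> bv; apply: (bdd_iter _ bv).
by rewrite /side_weight eqxx; case: s.
Qed.

End TensorBounded.

(** * Operators on formal sums *)

Section FormalSumOperators.
Variables (K : numFieldType) (N : nat) (eps1 eps2 : K).
Local Notation Y := (yangian N eps1 eps2).
Local Notation YY := (tensor Y Y).
Local Notation Fs := (int -> YY).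
Variable i : 'Z_N.
Local Notation adt := (@ad_tens K N eps1 eps2 i).

Definition finsupp (F : Fs) : Prop :=
  exists s : seq int, forall d, d \notin s -> F d = 0.

Definition total (F : Fs) : YY := \sum_(d \in [set: int]) F d.

Lemma total_lin a (F G : Fs) : finsupp F -> finsupp G ->
  total (a *: F + G) = a *: total F + total G.
Proof.
move=> [s sF] [t tG]; pose r := undup (s ++ t).
have rF d : d \notin r -> F d = 0.
  by rewrite mem_undup mem_cat negb_or => /andP[/sF].
have rG d : d \notin r -> G d = 0.
  by rewrite mem_undup mem_cat negb_or => /andP[_ /tG].
have ur : uniq r := undup_uniq _.
rewrite /total !(fsumE ur) //; last first.
  move=> d dr; transitivity (a *: F d + G d); first by [].
  by rewrite rF // rG // scaler0 addr0.
by rewrite scaler_sumr -big_split.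
Qed.

(* [Op] is the operator on formal sums which acts on the components as [op]
   does; it is local, so that it commutes with locally finite sums. *)
Record lifts (Op : Fs -> Fs) (op : YY -> YY) : Prop := {
  lifts_linear : linear Op;
  lifts_local : exists r : nat, forall F G e,
    (forall d, `|d - e| <= r%:Z -> F d = G d) -> Op F e = Op G e;
  lifts_homog F : (forall d, homog d (F d)) -> forall d, homog d (Op F d);
  lifts_total F : finsupp F -> total (Op F) = op (total F)
}.

Definition int_range (r : nat) (e : int) : seq int :=
  [seq e + (k%:Z - r%:Z) | k <- iota 0 (r + r).+1].

Lemma mem_int_range r e d : `|d - e| <= r%:Z -> d \in int_range r e.
Proof.
move=> de; apply/mapP; exists (absz (d - e + r%:Z)).
  by rewrite mem_iota; lia.
by lia.
Qed.

Lemma lifts_finsupp Op op F : lifts Op op -> finsupp F -> finsupp (Op F).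
Proof.
move=> [Ol [r rO] _ _] [s sF]; exists (flatten [seq int_range r d | d <- s]) => e es.
rewrite (rO F 0) ?(lin0 Ol) // => d de; apply: sF; apply: contra es => ds.
by apply/flatten_mapP; exists d => //; apply: mem_int_range; rewrite distrC.
Qed.

Lemma lifts_id : lifts id id.
Proof. by split=> //; exists 0%N => F G e FG; apply: FG; rewrite subrr. Qed.

Lemma lifts_comp Op op Op' op' : lifts Op op -> lifts Op' op' ->
  lifts (Op \o Op') (op \o op').
Proof.
move=> L L'; split.
- exact: lin_comp (lifts_linear L) (lifts_linear L').
- have [r rO] := lifts_local L; have [r' rO'] := lifts_local L'.
  exists (r + r')%N => F G e FG; apply: rO => d de; apply: rO' => c cd.
  by apply: FG; lia.
- by move=> F hF; apply: (lifts_homog L); apply: (lifts_homog L').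
- move=> F fF; rewrite /= (lifts_total L) ?(lifts_total L') //.
  exact: lifts_finsupp L' fF.
Qed.

Lemma lifts_lin a Op op Op' op' : lifts Op op -> lifts Op' op' ->
  lifts (fun F => a *: Op F + Op' F) (fun v => a *: op v + op' v).
Proof.
move=> L L'; split.
- move=> b x y; rewrite (lifts_linear L) (lifts_linear L') !scalerDr !scalerA.
  by rewrite addrACA [a * b]mulrC.
- have [r rO] := lifts_local L; have [r' rO'] := lifts_local L'.
  exists (r + r')%N => F G e FG; congr (a *: _ + _).
    by apply: rO => d de; apply: FG; lia.
  by apply: rO' => d de; apply: FG; lia.
- move=> F hF d; apply: homogD; first by apply: homogZ; apply: (lifts_homog L).
  exact: (lifts_homog L').
- move=> F fF; rewrite total_lin ?(lifts_total L) ?(lifts_total L') //.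
    exact: lifts_finsupp L fF.
  exact: lifts_finsupp L' fF.
Qed.

Lemma lifts_0 : lifts (fun=> 0) (fun=> 0).
Proof.
split=> //; first by move=> a x y; rewrite scaler0 addr0.
- by exists 0%N.
- by move=> F _ d; exact: homog0.
- by move=> F _; rewrite /total fsbig1.
Qed.

Lemma lifts_iter n Op op : lifts Op op -> lifts (iter n Op) (iter n op).
Proof.
move=> L; elim: n => [|n IH]; first exact: lifts_id.
exact: lifts_comp L IH.
Qed.

Lemma lifts_texp M Op op : lifts Op op -> lifts (texp M Op) (texp M op).
Proof.
move=> L; elim: M => [|M IH].
  have -> : texp 0 Op = fun=> 0 by apply/funext => F; rewrite /texp big_ord0.
  have -> : texp 0 op = fun=> 0 by apply/funext => F; rewrite /texp big_ord0.
  exact: lifts_0.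
have E (V : lmodType K) (A : V -> V) :
    texp M.+1 A = fun v => (M`!%:R)^-1 *: iter M A v + texp M A v.
  by apply/funext => v; rewrite /texp big_ord_recr addrC.
rewrite !E; apply: lifts_lin IH; exact: lifts_iter.
Qed.

Definition shift_ad (l : bool * bool) (F : Fs) : Fs :=
  fun d => adt l (F (d - tgen_degree l)).

Lemma lifts_shift_ad l : lifts (shift_ad l) (adt l).
Proof.
split.
- by move=> a F G; apply/funext => d; exact: ad_tens_linear.
- exists 1%N => F G e FG; congr (adt l _); apply: FG.
  by rewrite addrAC subrr add0r normrN; case: l => [[] []].
- by move=> F hF d; have := homog_ad_tens i l (hF (d - tgen_degree l)); rewrite addrC subrK.
- move=> F [r rF].
  have {r rF} [s us sF] : exists2 s : seq int, uniq s &
      forall e, e \notin s -> F e = 0.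
    by exists (undup r) => [|e]; rewrite ?undup_uniq // mem_undup => /rF.
  rewrite /total (fsumE us sF) (lin_sum (ad_tens_linear i l)).
  rewrite (fsumE (s := map (+%R^~ (tgen_degree l)) s)).
  + by rewrite big_map; apply: eq_bigr => d _; rewrite /shift_ad addrK.
  + by rewrite map_inj_uniq //; exact: addIr.
  + move=> d ds; rewrite /shift_ad sF ?(lin0 (ad_tens_linear i l)) //.
    apply: contra ds => ds; apply/mapP; exists (d - tgen_degree l) => //.
    by rewrite subrK.
Qed.

Lemma finsupp_conc d (v : YY) : finsupp (conc d v).
Proof. by exists [:: d] => e; rewrite inE /conc => /negbTE ->. Qed.

Lemma total_conc d (v : YY) : total (conc d v) = v.
Proof.
rewrite /total (fsumE (s := [:: d])) //.
  by rewrite big_seq1 /conc eqxx.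
by move=> e; rewrite inE /conc => /negbTE ->.
Qed.

(** [Op (conc d v)] has homogeneous components, finite support and total [op v]: it is the
    decomposition of [op v]. *)
Lemma emb_lift Op op d v : lifts Op op -> homog d v -> emb (op v) = Op (conc d v).
Proof.
move=> L hv; apply: emb_decomposition.
have hc e : homog e (conc d v e).
  by rewrite /conc; case: eqP => [->//|_]; exact: homog0.
have [s sF] := lifts_finsupp L (finsupp_conc d v).
split; first exact: lifts_homog L _ hc.
- exact: seq_finite_support sF.
- by rewrite -[RHS]/(total _) (lifts_total L) ?total_conc //; exact: finsupp_conc.
Qed.

(** The component of degree [d] reaches only degrees within [r] of [d]. With the lower bound [b],
    this leaves finitely many contributions up to any given degree. *)
Lemma csum_lift Op op (F : fsum N eps1 eps2) : lifts Op op -> in_completion F ->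
  csummable [set: int] (fun d => op (F d)) /\
  csum [set: int] (fun d => op (F d)) = Op F.
Proof.
move=> L [hF [b bF]]; have [r rO] := lifts_local L; have Ol := lifts_linear L.
have E d e : emb (op (F d)) e = Op (conc d (F d)) e by rewrite (emb_lift L (hF d)).
have far d e : r%:Z < `|d - e| -> emb (op (F d)) e = 0.
  move=> de; rewrite E (rO _ 0) ?(lin0 Ol) // => c ce.
  by rewrite /conc; case: eqP => // cd; rewrite cd leNgt de in ce.
split.
  move=> d.
  pose s := [seq b + k%:Z | k <- iota 0 (absz (d + r%:Z - b)%R).+1].
  have := finite_seq s; apply: sub_finite_set.
  move=> t [_ [e ed /eqP nz]] /=.
  have te : `|t - e| <= r%:Z by rewrite leNgt; apply/negP => /far.
  have bt : b <= t.
    rewrite leNgt; apply/negP => /bF Ft; apply: nz.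
    rewrite E (_ : conc t (F t) = 0) ?(lin0 Ol) //.
    by apply/funext => c; rewrite /conc Ft; case: ifP.
  suff : t \in s by [].
  apply/mapP; exists (absz (t - b)); last by lia.
  by rewrite mem_iota; lia.
apply/funext => e; rewrite /csum; pose s := undup (int_range r e).
rewrite (fsumE (s := s)) ?undup_uniq //; last first.
  move=> d; rewrite mem_undup => ds; apply: far; rewrite ltNge; apply: contra ds.
  exact: mem_int_range.
under eq_bigr do rewrite E.
have -> : \sum_(d <- s) Op (conc d (F d)) e = Op (\sum_(d <- s) conc d (F d)) e.
  rewrite (lin_sum Ol); elim: s => [|d s IH]; first by rewrite !big_nil.
  by rewrite !big_cons IH.
(* By locality, [F] may be replaced near [e] by the finite sum of its components there, to which
   linearity has been applied. *)
apply: rO => d de; have ds : d \in s by rewrite mem_undup; exact: mem_int_range.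
have -> : (\sum_(c <- s) conc c (F c)) d = \sum_(c <- s) conc c (F c) d.
  by elim: (s) => [|c t IH]; rewrite ?big_nil // !big_cons -IH.
rewrite (bigD1_seq d) ?undup_uniq //= /conc eqxx big1 ?addr0 // => c cd.
by rewrite eq_sym (negbTE cd).
Qed.

End FormalSumOperators.

(** * Braid operators and the coproduct *)

Section TensorExp.
Variables (K : numFieldType) (N : nat) (eps1 eps2 : K).
Local Notation Y := (yangian N eps1 eps2).
Variable iota : {linear affine_sl K N -> Y}.
Hypothesis iotaP : chevalley_embedding iota.
Variable i : 'Z_N.
Local Notation bg := (@braid_gen K N eps1 eps2 i).
Local Notation adg := (@ad_gen K N eps1 eps2 i).
Local Notation adt := (@ad_tens K N eps1 eps2 i).
Local Notation ybdd n := (bdd adg gen_weight n 0).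
Local Notation tbdd c n := (bdd adt (side_weight c) n 0).

Lemma exp_adE s n M y : ybdd n y -> (n <= M)%N ->
  exp_ad (bg s) y = texp M (adg s) y.
Proof.
move=> bn nM; rewrite /exp_ad (fsumE (s := index_iota 0 M)) ?iota_uniq //.
  by rewrite big_mkord.
move=> k; rewrite mem_index_iota leq0n /= -leqNgt => Mk.
rewrite -[iter k _ y]/(iter k (adg s) y) (bdd_iter _ bn) ?scaler0 //.
  by case: s.
exact: leq_trans Mk.
Qed.

(** A common bound for [x] and [y] also bounds their combination, so the three exponentials stop at
    the same order. *)
Lemma exp_ad_linear s : linear (exp_ad (bg s)).
Proof.
move=> a x y; have [n bx] := yangian_bdd i iotaP x.
have [p bp] := yangian_bdd i iotaP y; pose M := maxn n p.
have bx' := bdd_le (leq_maxl n p) bx; have by' := bdd_le (leq_maxr n p) bp.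
rewrite (exp_adE s bx' (leqnn _)) (exp_adE s by' (leqnn _)).
rewrite (exp_adE s (bdd_lin (ad_gen_linear i) a bx' by') (leqnn _)).
exact: texp_linear (ad_gen_linear i s) _ _ _.
Qed.

Lemma texp_tens c s M a b : texp M (adt (c, s)) (tens a b) =
  if c then tens (texp M (adg s) a) b else tens a (texp M (adg s) b).
Proof.
have E n : iter n (adt (c, s)) (tens a b) =
    if c then tens (iter n (adg s) a) b else tens a (iter n (adg s) b).
  elim: n => [|n IH] /=; first by case: c.
  by rewrite IH; case: c IH => _; rewrite ad_tens_tens.
rewrite /texp; case: c E => E.
  rewrite (lin_sum (@tens_linl _ _ _ b)); apply: eq_bigr => n _.
  by rewrite /divpow E (linZ (@tens_linl _ _ _ b)).
rewrite (lin_sum (@tens_linr _ _ _ a)); apply: eq_bigr => n _.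
by rewrite /divpow E (linZ (@tens_linr _ _ _ a)).
Qed.

(** The order needed for a decomposition of [v] into pure tensors depends on that decomposition; the
    bound on [v] itself then cuts it down to [n]. This gives one order for all components of an
    infinite sum. *)
Lemma tens_map_exp s n v : (forall c, tbdd c n v) ->
  tens_map (exp_ad (bg s)) (exp_ad (bg s)) v =
  texp n (adt (true, s)) (texp n (adt (false, s)) v).
Proof.
move=> bv; have L := exp_ad_linear s.
have [M0 HM] : exists M0, forall M, (M0 <= M)%N ->
    tens_map (exp_ad (bg s)) (exp_ad (bg s)) v =
    texp M (adt (true, s)) (texp M (adt (false, s)) v).
  (* The summands of [v] need not satisfy the bound on [v], which is therefore dropped before the
     induction. *)
  clear bv; elim/tensor_ind: v => [|x y [m Hm] [p Hp]|a b].
  - exists 0%N => M _; rewrite (lin0 (tens_map_linear L L)).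
    by rewrite !(lin0 (texp_linear _ (ad_tens_linear i _))).
  - exists (maxn m p) => M; rewrite geq_max => /andP[mM pM].
    rewrite (linD (tens_map_linear L L)) (Hm M) // (Hp M) //.
    by rewrite !(linD (texp_linear _ (ad_tens_linear i _))).
  - have [m ba] := yangian_bdd i iotaP a; have [p bb] := yangian_bdd i iotaP b.
    exists (maxn m p) => M; rewrite geq_max => /andP[mM pM].
    rewrite (tens_map_tens L L) (exp_adE s ba mM) (exp_adE s bb pM).
    by rewrite !texp_tens.
rewrite (HM (maxn M0 n)) ?leq_maxl //.
rewrite (@texp_trunc _ _ n _ (adt (false, s))) ?leq_maxr //; last first.
  by move=> k nk; apply: iter_ad_tens_eq0 nk.
rewrite (@texp_trunc _ _ n _ (adt (true, s))) ?leq_maxr // => k nk.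
apply: (@iter_ad_tens_eq0 _ _ _ _ _ _ n) => //.
rewrite /texp; apply: bdd_sum => [|q _]; first exact: ad_tens_linear.
by apply: bddZ; [exact: ad_tens_linear|exact: tbdd_iter_other].
Qed.

End TensorExp.

(** * Uniform bounds for the coproduct, and its compatibility with exponentials *)

Section Coproduct.
Variables (K : numFieldType) (N : nat) (eps1 eps2 : K).
Local Notation Y := (yangian N eps1 eps2).
Local Notation YY := (tensor Y Y).
Local Notation Fs := (int -> YY).
Local Notation g := (affine_sl K N).
Variables (iota : {linear g -> Y}) (m : nat) (u u' : 'I_m -> g).
Variables (mult : root_lattice N -> nat) (xr : root_lattice N -> nat -> g).
Variable Delta : Y -> fsum N eps1 eps2.
Hypothesis iotaP : chevalley_embedding iota.
Hypothesis DeltaP : is_coproduct iota u u' mult xr Delta.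
Variable i : 'Z_N.
Local Notation bg := (@braid_gen K N eps1 eps2 i).
Local Notation adg := (@ad_gen K N eps1 eps2 i).
Local Notation tg := (@tgen K N eps1 eps2 i).
Local Notation adt := (@ad_tens K N eps1 eps2 i).
Local Notation sad := (@shift_ad K N eps1 eps2 i).
Local Notation ybdd n := (bdd adg gen_weight n 0).
Local Notation tbdd c n := (bdd adt (side_weight c) n 0).

Lemma Delta_linear : linear (Delta : Y -> Fs).
Proof. by move=> a y z; apply/funext => d; exact: cop_linear DeltaP a y z d. Qed.

Lemma square_bdd c n y : (0 < n)%N -> ybdd n y -> tbdd c n (square y).
Proof.
move=> n0 bn; have b1 : ybdd n 1 by apply: bdd_le (ybdd1 eps1 eps2 i).
by rewrite /square; apply: bddD; first exact: ad_tens_linear;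
  apply: tens_bdd; case: c.
Qed.

(** The terms of the sum over [Omega_+] are tensors of elements in the image of [iota], all bounded
    by 3; with [yht1] bounded by 8, the coproducts of the generators are uniformly bounded, and
    products add bounds. *)
Lemma Delta_bdd y : exists n, forall c d, tbdd c n (Delta y d).
Proof.
have lin := @ad_tens_linear K N eps1 eps2 i.
elim/yangian_ind: y => [a y z [n bn] [p bp]||y z [n bn] [p bp]|s j|j].
- exists (maxn n p) => c d; rewrite (cop_linear DeltaP); apply: bdd_lin => //.
    exact: bdd_le (leq_maxl n p) (bn c d).
  exact: bdd_le (leq_maxr n p) (bp c d).
- exists 1%N => c d; rewrite (cop_one DeltaP); apply: emb_bdd.
  by rewrite [1]/(tens 1 1); apply: tens_bdd; case: c; exact: ybdd1.
- exists (n + p)%N => c d; rewrite (cop_mul DeltaP).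
  by apply: cmul_bdd => e; [exact: bn|exact: bp].
- exists 3%N => c d; rewrite (cop_x DeltaP); apply: emb_bdd.
  by apply: square_bdd => //; exact: x0_bdd iotaP s j.
- exists 8%N => c d; rewrite (cop_h1 DeltaP); apply: bddD => //.
    by apply: emb_bdd; apply: square_bdd => //; exact: ht1_bdd iotaP j.
  apply: bddZ => //; apply: (@bdd_le _ _ _ _ _ 3) => //.
  by apply: csum_bdd => t; apply: tens_bdd; case: c; exact: iota_bdd.
Qed.

Lemma Delta_gen s : Delta (bg s) =
  conc (tgen_degree (true, s)) (tg (true, s))
    + conc (tgen_degree (false, s)) (tg (false, s)) :> Fs.
Proof.
set F : Fs := _ + _.
have F1 c : finsupp (conc (tgen_degree (c, s)) (tg (c, s))) := finsupp_conc _ _.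
have FE : F = 1 *: conc (tgen_degree (true, s)) (tg (true, s))
    + conc (tgen_degree (false, s)) (tg (false, s)) by rewrite scale1r.
have hF d : homog d (F d).
  have hc c : homog d (conc (tgen_degree (c, s)) (tg (c, s)) d).
    rewrite /conc; case: eqP => [->|_]; last exact: homog0.
    exact: homog_tgen.
  exact: homogD (hc true) (hc false).
have sF : finsupp F.
  exists [:: tgen_degree (true, s); tgen_degree (false, s)] => d.
  rewrite !inE negb_or => /andP[d1 d2].
  transitivity (conc (tgen_degree (true, s)) (tg (true, s)) d
    + conc (tgen_degree (false, s)) (tg (false, s)) d); first by [].
  by rewrite /conc (negbTE d1) (negbTE d2) addr0.
have tF : total F = tg (true, s) + tg (false, s).
  by rewrite FE total_lin // !total_conc scale1r.
(* The scalar serves both signs: 1 for [x_i^+], and -1 for [x_i^-], which is the opposite of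
   [braid_gen false]. *)
have key a : is_decomposition (a *: (tg (true, s) + tg (false, s))) (a *: F).
  split.
  - by move=> d; exact: homogZ.
  - have [t tF'] := sF; apply: (@seq_finite_support _ _ _ t) => d /tF' Fd.
    transitivity (a *: F d); first by [].
    by rewrite Fd scaler0.
  - have f0 : finsupp (0 : Fs) by exists [::].
    have := total_lin a sF f0; rewrite addr0 tF => E.
    have t0 : total (0 : Fs) = 0 by apply: fsbig1 => d _.
    by rewrite t0 addr0 in E; exact: esym E.
case: s @F F1 FE hF sF tF key => F _ _ _ _ _ key; rewrite /braid_gen.
  rewrite (cop_x DeltaP); apply: emb_decomposition.
  by have := key 1; rewrite !scale1r.
rewrite (linN Delta_linear) (cop_x DeltaP) (_ : emb _ = - F) ?opprK //.
apply: emb_decomposition; have := key (-1); rewrite !scaleN1r opprD.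
rewrite /tgen /= /braid_gen (linN (@tens_linl _ _ _ _)) (linN (@tens_linr _ _ _ _)).
by rewrite !opprK.
Qed.

(** The coproduct of the generator has two components, in degrees 1 and -1, so each convolution has
    two terms, and these pair up into commutators. *)
Lemma Delta_ad s y :
  Delta (adg s y) = sad (true, s) (Delta y) + sad (false, s) (Delta y) :> Fs.
Proof.
have dn : tgen_degree (true, s) != tgen_degree (false, s) by case: s.
have DE d : Delta (bg s) d = conc (tgen_degree (true, s)) (tg (true, s)) d
    + conc (tgen_degree (false, s)) (tg (false, s)) d by rewrite Delta_gen.
have D1 : Delta (bg s) (tgen_degree (true, s)) = tg (true, s).
  by rewrite DE /conc eqxx (negbTE dn) addr0.
have D2 : Delta (bg s) (tgen_degree (false, s)) = tg (false, s).
  by rewrite DE /conc eqxx eq_sym (negbTE dn) add0r.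
have D0 e : e != tgen_degree (true, s) -> e != tgen_degree (false, s) ->
    Delta (bg s) e = 0.
  by move=> /negbTE e1 /negbTE e2; rewrite DE /conc e1 e2 addr0.
rewrite /ad_gen /lie (linB Delta_linear) !(cop_mul DeltaP); apply/funext => d.
have -> : (sad (true, s) (Delta y) + sad (false, s) (Delta y)) d =
    adt (true, s) (Delta y (d - tgen_degree (true, s))) +
    adt (false, s) (Delta y (d - tgen_degree (false, s))) by [].
transitivity (cmul (Delta (bg s)) (Delta y) d - cmul (Delta y) (Delta (bg s)) d).
  by [].
rewrite /cmul.
rewrite (fsumE (s := [:: tgen_degree (true, s); tgen_degree (false, s)])).
- rewrite (fsumE (s := [:: d - tgen_degree (true, s); d - tgen_degree (false, s)])).
  + rewrite !big_cons !big_nil !addr0 !subKr D1 D2 opprD addrACA.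
    by [].
  + by rewrite /= inE andbT (inj_eq (subrI _)).
  + move=> e; rewrite !inE negb_or => /andP[e1 e2]; rewrite D0 ?mulr0 //.
      by apply: contra e1 => /eqP <-; rewrite subKr.
    by apply: contra e2 => /eqP <-; rewrite subKr.
- by rewrite /= inE andbT.
- by move=> e; rewrite !inE negb_or => /andP[e1 e2]; rewrite D0 ?mul0r.
Qed.

Lemma Delta_exp s n y : (forall c d, tbdd c n (Delta y d)) ->
  Delta (exp_ad (bg s) y) =
  texp n (sad (true, s)) (texp n (sad (false, s)) (Delta y)) :> Fs.
Proof.
move=> bD; have [p bp] := yangian_bdd i iotaP y; pose M := maxn p (n + n).
rewrite (exp_adE s bp (leq_maxl p (n + n))) -/M.
have sl l : linear (sad l) := lifts_linear (lifts_shift_ad _ _ i l).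
rewrite -(@texpD _ _ n M) //; last by rewrite leq_maxr.
- rewrite /texp (lin_sum Delta_linear); apply: eq_bigr => k _.
  rewrite /divpow (linZ Delta_linear); congr (_ *: _).
  by elim: (nat_of_ord k) => //= j IH; rewrite Delta_ad IH.
- move=> F; apply/funext => d; rewrite /shift_ad addrAC.
  exact: ad_tens_comm.
- move=> k q kq.
  have it l j (F : Fs) d : iter j (sad l) F d =
      iter j (adt l) (F (d - tgen_degree l *+ j)).
    elim: j d => [|j IH] d /=; first by rewrite mulr0n subr0.
    by rewrite {1}/shift_ad IH mulrS opprD addrA.
  apply/funext => d; rewrite !it; case/orP: kq => [nk|nq].
    rewrite (iter_ad_tens_eq0 (n := n)) //.
    by apply: tbdd_iter_other.
  rewrite (iter_ad_tens_eq0 s (bD false _) nq).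
  by rewrite (lin0 (lin_iter _ (ad_tens_linear i _))).
Qed.

Lemma Delta_braid y :
  csummable [set: int] (fun d => tens_map (braid i) (braid i) (Delta y d)) /\
  Delta (braid i y) =
    csum [set: int] (fun d => tens_map (braid i) (braid i) (Delta y d)).
Proof.
pose E s := exp_ad (bg s); pose y1 := E true y; pose y2 := E false y1.
have [n0 b0] := Delta_bdd y; have [p1 c1] := Delta_bdd y1.
have [p2 c2] := Delta_bdd y2.
(* [n1] has to bound the components of [Delta y1] and also the images under [op n0 true] of those of
   [Delta y], where each of the two truncated exponentials adds [n0] to the bound. The same holds
   for [n2], one stage later. *)
pose n1 := maxn p1 (n0 + n0 + n0); pose n2 := maxn p2 (n1 + n1 + n1).
pose op n s v := texp n (adt (true, s)) (texp n (adt (false, s)) v).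
pose Op n s (F : Fs) := texp n (sad (true, s)) (texp n (sad (false, s)) F).
have L n s : lifts (Op n s) (op n s).
  by apply: lifts_comp; apply: lifts_texp; exact: lifts_shift_ad.
have LL : lifts (Op n2 true \o (Op n1 false \o Op n0 true))
    (op n2 true \o (op n1 false \o op n0 true)).
  exact: lifts_comp (L _ _) (lifts_comp (L _ _) (L _ _)).
have opb n s v : (forall c, tbdd c n v) -> forall c, tbdd c (n + n + n) (op n s v).
  by move=> bv c; do 2! apply: tbdd_texp.
have El s : linear (E s) := exp_ad_linear iotaP i s.
have -> : (fun d => tens_map (braid i) (braid i) (Delta y d)) =
    (fun d => (op n2 true \o (op n1 false \o op n0 true)) (Delta y d)).
  apply/funext => d; rewrite -[braid i]/(E true \o (E false \o E true)).
  have bv0 c : tbdd c n0 (Delta y d) := b0 c d.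
  have bv1 c : tbdd c n1 (op n0 true (Delta y d)).
    by apply: bdd_le (opb _ _ _ bv0 c); exact: leq_maxr.
  have bv2 c : tbdd c n2 (op n1 false (op n0 true (Delta y d))).
    by apply: bdd_le (opb _ _ _ bv1 c); exact: leq_maxr.
  have opE n s v : (forall c, tbdd c n v) -> tens_map (E s) (E s) v = op n s v.
    by move=> bv; exact: (tens_map_exp iotaP s bv).
  rewrite (tens_map_comp _ (El true) (lin_comp (El false) (El true))).
  rewrite (tens_map_comp _ (El false) (El true)).
  by rewrite (opE _ _ _ bv0) (opE _ _ _ bv1) (opE _ _ _ bv2).
have [S ->] := csum_lift LL (cop_completion DeltaP y); split=> //.
have b1 c d : tbdd c n1 (Delta y1 d).
  by apply: bdd_le (c1 c d); exact: leq_maxl.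
have b2 c d : tbdd c n2 (Delta y2 d).
  by apply: bdd_le (c2 c d); exact: leq_maxl.
have D1 := Delta_exp true b0; have D2 := Delta_exp false b1.
have D3 := Delta_exp true b2.
by rewrite [LHS]D3 D2 D1.
Qed.

End Coproduct.

Theorem proposition3p12 (R : realType) (N : nat) (N_ge3 : (3 <= N)%N)
  (eps1 eps2 : R[i])
  (iota : {linear affine_sl R[i] N -> yangian N eps1 eps2})
  (B : affine_sl R[i] N -> affine_sl R[i] N -> R[i])
  (u u' : 'I_N.+1 -> affine_sl R[i] N)
  (mult : root_lattice N -> nat)
  (xr : root_lattice N -> nat -> affine_sl R[i] N)
  (Delta : yangian N eps1 eps2 -> fsum N eps1 eps2)
  (iotaP : chevalley_embedding iota)
  (BP : normalized_form B)
  (uP : cartan_dual_bases B u u')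
  (xrP : root_vectors B mult xr)
  (DeltaP : is_coproduct iota u u' mult xr Delta)
  (i : 'Z_N) (y : yangian N eps1 eps2) :
  csummable [set: int] (fun d => tens_map (braid i) (braid i) (Delta y d)) /\
  Delta (braid i y) =
    csum [set: int] (fun d => tens_map (braid i) (braid i) (Delta y d)).
Proof. exact: Delta_braid iotaP DeltaP i y. Qed.
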